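(* Let $A\in\mathbb{N}_{\geq 0}^{m\times n}$, $b\in\mathbb{N}_{>0}^m$, $c\in\mathbb{Z}^n$, the finite set $S\subseteq\mathbb{R}^n_{\ge0}\setminus\{0\}$, the cone $C$ generated by $S$, and $N$ be as in the context. Given a strongly combinatorial and strongly polynomial-time separation oracle $\mathcal{A}$ for $S$ running in $T_\mathcal{A}$ time, there is a strongly polynomial FPTAS for the problem $\max\{c^Tx: Ax\le b,\ x\in C\}$ running in $\mathcal{O}\left(\frac{1}{\varepsilon^2}\cdot m\log m\cdot(N+T_\mathcal{A})+T_\mathcal{A}^2\right)$ time.
   Context: Setting: $A\in\mathbb{N}_{\geq 0}^{m\times n}$ has non-negative integer entries and at least one positive entry in each row and each column; $b\in\mathbb{N}_{>0}^m$; $c\in\mathbb{Z}^n$ has entries of arbitrary sign; $N$ is the number of non-zero entries of $A$. $S=\{x^{(1)},\dots,x^{(k)}\}$ is a finite set of non-zero vectors in $\mathbb{R}^n_{\ge0}$ and $C=\{\sum_l\alpha_lx^{(l)}:\alpha_l\ge0\}$ the cone it generates, accessed only through an oracle (the cone is assumed well-described). A separation oracle for $S$ receives $d\in\mathbb{R}^n$ and either states that $d^Tx^{(i)}\ge0$ for all $x^{(i)}\in S$ or returns some $x^{(l)}\in S$ with $d^Tx^{(l)}<0$; $T_\mathcal{A}\in\Omega(n)$. Strongly combinatorial: the oracle only performs additions, subtractions, multiplications by constants and comparisons on values depending on its input. An FPTAS receives an instance and $\varepsilon\in(0,1)$ and outputs a feasible $x$ with $c^Tx\ge(1-\varepsilon)$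 times the optimum, in time polynomial in the encoding size and $1/\varepsilon$; strongly polynomial means the number of operations is independent of the magnitudes of the numbers in the input. *)

(* Defs.v *)
From mathcomp Require Import all_boot all_order all_algebra.
From mathcomp Require Import all_classical.
From mathcomp Require Import reals exp.

Set Implicit Arguments.
Unset Strict Implicit.
Unset Printing Implicit Defensive.

Import Order.TTheory GRing.Theory Num.Theory.
Local Open Scope ring_scope.

(******************************************************************************)
(* Machine model: a unit-cost real RAM, programmed in a structured language.  *)
(*                                                                            *)
(* A program has read-only input files of naturals and of reals, and a work   *)
(* memory consisting of arrays of naturals (used for indices) and of arrays   *)
(* of reals; files and arrays are numbered by constants of the program, cells *)
(* are addressed by computed indices.  Reals nonzeros the field operations and *)
(* comparisons only.  Indices nonzeros addition, truncated subtraction and     *)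
(* comparisons only: unit-cost multiplication of unbounded naturals would     *)
(* make the model unrealistically strong.  Programs contain no real constants *)
(* other than naturals.                                                       *)
(******************************************************************************)

Inductive iexp : Type :=
| IConst of nat
| IFile of nat & iexp
| ILoad of nat & iexp
| IAdd of iexp & iexp
| ISub of iexp & iexp.

Inductive rexp : Type :=
| RConst of nat
| RFile of nat & iexp
| RLoad of nat & iexp
| RAdd of rexp & rexp
| RSub of rexp & rexp
| RMul of rexp & rexp
| RDiv of rexp & rexp.

Inductive test : Type :=
| ILe of iexp & iexp
| RLe of rexp & rexp.

Inductive cmd : Type :=
| Skip
| ISet of nat & iexp & iexp
| RSet of nat & iexp & rexp
| Seq of cmd & cmd
| If of test & cmd & cmd
| While of test & cmd.

Record input (R : Type) := Input {
  ifile : nat -> seq nat;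
  rfile : nat -> seq R }.

Record store (R : Type) := Store {
  imem : nat -> nat -> nat;
  rmem : nat -> nat -> R }.

Definition upd (T : Type) (f : nat -> nat -> T) (a i : nat) (v : T) :
    nat -> nat -> T :=
  fun a' i' => if (a' == a) && (i' == i) then v else f a' i'.

Section Semantics.
Variable R : realType.
Variable inp : input R.

Fixpoint ieval (s : store R) (e : iexp) : nat :=
  match e with
  | IConst k => k
  | IFile f i => nth 0%N (ifile inp f) (ieval s i)
  | ILoad a i => imem s a (ieval s i)
  | IAdd e1 e2 => (ieval s e1 + ieval s e2)%N
  | ISub e1 e2 => (ieval s e1 - ieval s e2)%N
  end.

Fixpoint reval (s : store R) (e : rexp) : R :=
  match e with
  | RConst k => k%:R
  | RFile f i => nth 0 (rfile inp f) (ieval s i)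
  | RLoad a i => rmem s a (ieval s i)
  | RAdd e1 e2 => reval s e1 + reval s e2
  | RSub e1 e2 => reval s e1 - reval s e2
  | RMul e1 e2 => reval s e1 * reval s e2
  | RDiv e1 e2 => reval s e1 / reval s e2
  end.

Definition teval (s : store R) (t : test) : bool :=
  match t with
  | ILe e1 e2 => (ieval s e1 <= ieval s e2)%N
  | RLe e1 e2 => reval s e1 <= reval s e2
  end.

Fixpoint icost (e : iexp) : nat :=
  match e with
  | IConst _ => 1
  | IFile _ i | ILoad _ i => (icost i).+1
  | IAdd e1 e2 | ISub e1 e2 => (icost e1 + icost e2).+1
  end.

Fixpoint rcost (e : rexp) : nat :=
  match e with
  | RConst _ => 1
  | RFile _ i | RLoad _ i => (icost i).+1
  | RAdd e1 e2 | RSub e1 e2 | RMul e1 e2 | RDiv e1 e2 =>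
      (rcost e1 + rcost e2).+1
  end.

Definition tcost (t : test) : nat :=
  match t with
  | ILe e1 e2 => (icost e1 + icost e2).+1
  | RLe e1 e2 => (rcost e1 + rcost e2).+1
  end.

(* [run p s s' t]: started in the store s, the program p halts in the store
   s' after t elementary steps. *)
Inductive run : cmd -> store R -> store R -> nat -> Prop :=
| run_skip s : run Skip s s 1
| run_iset a i e s :
    run (ISet a i e) s
      (Store (upd (imem s) a (ieval s i) (ieval s e)) (rmem s))
      (icost i + icost e).+1
| run_rset a i e s :
    run (RSet a i e) s
      (Store (imem s) (upd (rmem s) a (ieval s i) (reval s e)))
      (icost i + rcost e).+1
| run_seq p1 p2 s s1 s2 t1 t2 :
    run p1 s s1 t1 -> run p2 s1 s2 t2 -> run (Seq p1 p2) s s2 (t1 + t2).+1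
| run_if b p1 p2 s s' t :
    run (if teval s b then p1 else p2) s s' t ->
    run (If b p1 p2) s s' (tcost b + t).+1
| run_while_stop b p s :
    ~~ teval s b -> run (While b p) s s (tcost b).+1
| run_while_step b p s s1 s2 t1 t2 :
    teval s b -> run p s s1 t1 -> run (While b p) s1 s2 t2 ->
    run (While b p) s s2 (tcost b + t1 + t2).+1.

End Semantics.

(******************************************************************************)
(* Strongly combinatorial programs: dep a = true marks the real arrays whose  *)
(* contents may depend on the query vector, which is supplied in array 0.     *)
(* Everything else (program constants, input files, unmarked arrays) is       *)
(* constant with respect to the query.                                        *)
(******************************************************************************)

Fixpoint depends (dep : pred nat) (e : rexp) : bool :=
  match e with
  | RConst _ | RFile _ _ => false
  | RLoad a _ => dep a
  | RAdd e1 e2 | RSub e1 e2 | RMul e1 e2 | RDiv e1 e2 =>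
      depends dep e1 || depends dep e2
  end.

Fixpoint combinatorial_rexp (dep : pred nat) (e : rexp) : bool :=
  match e with
  | RConst _ | RFile _ _ | RLoad _ _ => true
  | RAdd e1 e2 | RSub e1 e2 =>
      combinatorial_rexp dep e1 && combinatorial_rexp dep e2
  | RMul e1 e2 =>
      [&& combinatorial_rexp dep e1, combinatorial_rexp dep e2
        & ~~ (depends dep e1 && depends dep e2)]
  | RDiv e1 e2 =>
      [&& combinatorial_rexp dep e1, combinatorial_rexp dep e2
        & ~~ (depends dep e1 || depends dep e2)]
  end.

Definition combinatorial_test (dep : pred nat) (t : test) : bool :=
  match t with
  | ILe _ _ => true
  | RLe e1 e2 => combinatorial_rexp dep e1 && combinatorial_rexp dep e2
  end.

Fixpoint combinatorial_cmd (dep : pred nat) (p : cmd) : bool :=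
  match p with
  | Skip | ISet _ _ _ => true
  | RSet a _ e => combinatorial_rexp dep e && (depends dep e ==> dep a)
  | Seq p1 p2 => combinatorial_cmd dep p1 && combinatorial_cmd dep p2
  | If b p1 p2 =>
      [&& combinatorial_test dep b, combinatorial_cmd dep p1
        & combinatorial_cmd dep p2]
  | While b p1 => combinatorial_test dep b && combinatorial_cmd dep p1
  end.

Definition strongly_combinatorial (p : cmd) : Prop :=
  exists dep : pred nat, dep 0%N /\ combinatorial_cmd dep p.

Section Packing.
Variable R : realType.

Definition dotp (n : nat) (u v : 'cV[R]_n) : R := \sum_j u j 0 * v j 0.

(* An instance of the generating set S.  The algorithms see only the dimension
   and the description (idesc, rdesc), e.g. a graph together with its edge
   data; the finite set gens = S itself is not part of any program's input and
   may be of exponential size. *)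
Record cone_inst := ConeInst {
  cone_dim : nat;
  idesc : seq nat;
  rdesc : seq R;
  gens : seq 'cV[R]_cone_dim }.

Definition gens_ok (I : cone_inst) : Prop :=
  forall x, x \in gens I -> x != 0 /\ (forall j, 0 <= x j 0).

Definition in_cone (n : nat) (S : seq 'cV[R]_n) (x : 'cV[R]_n) : Prop :=
  exists2 alpha : 'I_(size S) -> R,
    (forall l, 0 <= alpha l) & x = \sum_l alpha l *: S`_l.

Definition cone_size (I : cone_inst) : nat :=
  (cone_dim I + size (idesc I) + size (rdesc I))%N.

Definition holds_vec (n : nat) (s : store R) (a : nat) (x : 'cV[R]_n) : Prop :=
  forall j : 'I_n, rmem s a j = x j 0.

Definition oracle_input (I : cone_inst) : input R :=
  Input (fun f => match f with 0 => idesc I | 1 => [:: cone_dim I] | _ => [::] end)%N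
        (fun f => match f with 0 => rdesc I | _ => [::] end)%N.

(* The query d is supplied in real array 0; all other work cells are
   uninitialised, i.e. arbitrary.  The answer is left in cell 0 of index array
   0 (0 for "d^T x >= 0 on S", nonzero for "violated"), the violating element
   of S in real array 1. *)
Definition separation_oracle (F : cone_inst -> Prop) (p : cmd)
    (T : cone_inst -> nat) : Prop :=
  forall (I : cone_inst), F I ->
  forall (d : 'cV[R]_(cone_dim I)) (s : store R), holds_vec s 0 d ->
  exists s' t, [/\ run (oracle_input I) p s s' t, (t <= T I)%N &
    if imem s' 0 0 == 0%N then forall x, x \in gens I -> 0 <= dotp d x
    else exists x, [/\ x \in gens I, dotp d x < 0 & holds_vec s' 1 x]].

(* Polynomial in the number of input numbers, whatever their magnitudes. *)
Definition strongly_polynomial (F : cone_inst -> Prop)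
    (T : cone_inst -> nat) : Prop :=
  exists k : nat, forall I, F I -> (T I <= k * (cone_size I).+1 ^ k)%N.

Record packing := Packing {
  pcone : cone_inst;
  nrows : nat;
  matA : 'M[nat]_(nrows, cone_dim pcone);
  vecb : 'cV[nat]_nrows;
  vecc : 'cV[int]_(cone_dim pcone) }.

Definition packing_ok (J : packing) : Prop :=
  [/\ forall i, exists j, (0 < matA J i j)%N,
      forall j, exists i, (0 < matA J i j)%N &
      forall i, (0 < vecb J i 0%R)%N].

Definition nonzeros (J : packing) : {set 'I_(nrows J) * 'I_(cone_dim (pcone J))} :=
  [set ij | matA J ij.1 ij.2 != 0%N].

Definition nnz (J : packing) : nat := #|nonzeros J|.

Definition objective (J : packing) (x : 'cV[R]_(cone_dim (pcone J))) : R :=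
  dotp (map_mx intr (vecc J)) x.

Arguments objective J x : clear implicits.

Definition feasible (J : packing) (x : 'cV[R]_(cone_dim (pcone J))) : Prop :=
  (forall i, (map_mx (GRing.natmul 1) (matA J) *m x) i 0 <= (vecb J i 0)%:R) /\
  in_cone (gens (pcone J)) x.

Arguments feasible J x : clear implicits.

Definition optimum (J : packing) : R :=
  sup [set v | exists2 x, feasible J x & v = objective J x]%classic.

(* A is given by the list of its nonzero entries (rows, columns, values). *)
Definition packing_input (J : packing) (eps : R) : input R :=
  Input (fun f => match f with
           | 0 => idesc (pcone J)
           | 1 => [:: cone_dim (pcone J)]
           | 2 => [:: nrows J; nnz J]
           | 3 => [seq nat_of_ord ij.1 | ij <- enum (nonzeros J)]
           | 4 => [seq nat_of_ord ij.2 | ij <- enum (nonzeros J)]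
           | _ => [::]
           end)%N
        (fun f => match f with
           | 0%N => rdesc (pcone J)
           | 1%N => [seq (matA J ij.1 ij.2)%:R | ij <- enum (nonzeros J)]
           | 2%N => [seq (vecb J i 0)%:R | i <- enum 'I_(nrows J)]
           | 3%N => [seq (vecc J j 0)%:~R | j <- enum 'I_(cone_dim (pcone J))]
           | 4%N => [:: eps]
           | _ => [::]
           end).

Definition packing_size (J : packing) : nat :=
  (cone_size (pcone J) + nrows J + nnz J)%N.

Definition runs_within (F : cone_inst -> Prop) (p : cmd)
    (f : packing -> R -> R) : Prop :=
  forall (J : packing) (eps : R), F (pcone J) -> packing_ok J ->
  0 < eps < 1 -> forall s : store R,
  exists s' t, run (packing_input J eps) p s s' t /\ t%:R <= f J eps.

(* The solution is left in real array 1. *)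
Definition approximates (F : cone_inst -> Prop) (p : cmd) : Prop :=
  forall (J : packing) (eps : R), F (pcone J) -> packing_ok J ->
  0 < eps < 1 -> forall s : store R,
  exists s' t x, [/\ run (packing_input J eps) p s s' t, holds_vec s' 1 x,
    feasible J x & (1 - eps) * optimum J <= objective J x].

Definition strongly_polynomial_FPTAS (F : cone_inst -> Prop) (p : cmd) : Prop :=
  approximates F p /\
  exists k : nat, runs_within F p
    (fun J eps => k%:R * ((packing_size J)%:R + eps^-1) ^+ k).

End Packing.

(* Main.v *)
Require Import Defs.
From mathcomp Require Import all_boot all_order all_algebra.
From mathcomp Require Import all_classical.
From mathcomp Require Import reals sequences exp.
From mathcomp Require Import zify ring lra.

   
                                                                              
                                                                           
                                                                            
                                                                       
                                                                            
                                                                              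
                                                                          
                                                                             
                                                                             
                                                                              
                                                                       

                                                                            
                                                                            
                                                                        
                                                                             
                                                                              
                                                           
  

Set Implicit Arguments.
Unset Strict Implicit.
Unset Printing Implicit Defensive.

Import Order.TTheory GRing.Theory Num.Theory.
Local Open Scope ring_scope.

(** The algorithm is a width-independent multiplicative weights method of Garg-Koenemann type,
    started by one parametric search.

    Rows carry weights [y], initially [1 / b], and each [x] in [S] has the ratio
    [c^T x / (A^T y)^T x]. A number [mu] bounds all ratios from above. One oracle query at
    [mu / (1 + e) A^T y - c] tests whether [mu / (1 + e)] is still a bound. If so, [mu] is divided
    by [1 + e]. Otherwise the returned [x] has a ratio within the factor [1 + e] of every other one.
    It is scaled so that its largest relative load [(A x)_i / b_i] is 1, it is added to [X], and
    [y_i] is multiplied by [1 + e w_i], where [w_i] is the scaled load.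

    The invariant [mw_inv] keeps [y_i b_i] between two exponentials of the accumulated load [L_i].
    By weak duality ([objective_le_weights]) it also bounds the sum of the [y_i b_i] by an
    exponential of [c^T X / c^T z] for every feasible [z] of positive objective. Once the largest
    load exceeds [log m / e^2], comparing the two shows that [X] divided by this load is feasible
    and optimal up to the factor [1 - 3 e] ([mw_final]); [e] is [eps / 3]. Loads and [mu] together
    limit the number of iterations to order [m log m / eps^2] ([mw_iterations], [mw_step]).

    The first [mu] has to be the exact maximum [lam] of the initial ratios, so that the number of
    reductions of [mu] does not depend on the magnitudes of the numbers. It is found by Megiddo's
    method. The oracle is run on the query [l A^T y - c] with [l] undetermined. Since the oracle is
    strongly combinatorial, every value depending on the query stays affine in [l], and a comparison
    asks on which side of the root of an affine function [l] lies; a call of the oracle at that root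
    answers this ([resolve_ok]). The undetermined [l] is formalised by a filter, namely the values
    just below [lam] ([sim_ok]). There the oracle must report a violation, and the vector it
    returns, affine in [l] with finitely many values, is constant and attains [lam]
    ([parametric_search]). The search makes at most one oracle call per simulated step, which costs
    [T^2] up to a constant because [T] is at least of order [n]. *)

Fixpoint iwrites (p : cmd) (a : nat) : bool :=
  match p with
  | ISet b _ _ => a == b
  | Seq p1 p2 | If _ p1 p2 => iwrites p1 a || iwrites p2 a
  | While _ p1 => iwrites p1 a
  | _ => false
  end.

Fixpoint rwrites (p : cmd) (a : nat) : bool :=
  match p with
  | RSet b _ _ => a == b
  | Seq p1 p2 | If _ p1 p2 => rwrites p1 a || rwrites p2 a
  | While _ p1 => rwrites p1 a
  | _ => false
  end.

(** * Execution of programs: determinism, frame rules and cost rules *)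

Section Runs.
Variables (R : realType) (inp : input R).
Implicit Types (s : store R) (p : cmd).

Lemma run_gt0 p s s' t : run inp p s s' t -> (0 < t)%N.
Proof. by case. Qed.

Lemma run_inv p s s' t : run inp p s s' t ->
  match p with
  | Skip => s' = s /\ t = 1%N
  | ISet a i e =>
      s' = Store (upd (imem s) a (ieval inp s i) (ieval inp s e)) (rmem s) /\
      t = (icost i + icost e).+1
  | RSet a i e =>
      s' = Store (imem s) (upd (rmem s) a (ieval inp s i) (reval inp s e)) /\
      t = (icost i + rcost e).+1
  | Seq p1 p2 => exists s1 t1 t2,
      [/\ run inp p1 s s1 t1, run inp p2 s1 s' t2 & t = (t1 + t2).+1]
  | If b p1 p2 => exists2 t1,
      run inp (if teval inp s b then p1 else p2) s s' t1 & t = (tcost b + t1).+1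
  | While b p1 =>
      if teval inp s b then exists s1 t1 t2,
        [/\ run inp p1 s s1 t1, run inp (While b p1) s1 s' t2 &
            t = (tcost b + t1 + t2).+1]
      else s' = s /\ t = (tcost b).+1
  end.
Proof.
case=> {p s s' t} //=.
- by move=> p1 p2 s s1 s2 t1 t2 r1 r2; exists s1, t1, t2.
- by move=> b p1 p2 s s' t r; exists t.
- by move=> b p s /negPf->.
- by move=> b p s s1 s2 t1 t2 -> r1 r2; exists s1, t1, t2.
Qed.

(** Determinism lets a run that has been constructed inherit the time bound and the postcondition of
    the run promised by the oracle specification. *)
Lemma run_det p s s1 s2 t1 t2 :
  run inp p s s1 t1 -> run inp p s s2 t2 -> s1 = s2 /\ t1 = t2.
Proof.
move=> H; elim: H s2 t2 => {p s s1 t1}.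
- by move=> s s2 t2 /run_inv[-> ->].
- by move=> a i e s s2 t2 /run_inv[-> ->].
- by move=> a i e s s2 t2 /run_inv[-> ->].
- move=> p1 p2 s s1 s2 t1 t2 _ IH1 _ IH2 s3 t3 /run_inv[u [u1 [u2 [r1 r2 ->]]]].
  by have [? ?] := IH1 _ _ r1; subst; have [? ?] := IH2 _ _ r2; subst.
- move=> b p1 p2 s s' t _ IH s3 t3 /run_inv[u r ->].
  by have [? ?] := IH _ _ r; subst.
- by move=> b p s /negPf nb s3 t3 /run_inv; rewrite nb => -[-> ->].
- move=> b p s s1 s2 t1 t2 bs _ IH1 _ IH2 s3 t3 /run_inv; rewrite bs.
  move=> [u [u1 [u2 [r1 r2 ->]]]].
  by have [? ?] := IH1 _ _ r1; subst; have [? ?] := IH2 _ _ r2; subst.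
Qed.

Lemma run_iwrites p s s' t a :
  run inp p s s' t -> ~~ iwrites p a -> imem s' a = imem s a.
Proof.
elim=> {p s s' t} //=.
- by move=> b i e s nab; apply/funext => k; rewrite /upd (negPf nab).
- by move=> p1 p2 s s1 s2 t1 t2 _ IH1 _ IH2; case/norP => /IH1 <- /IH2.
- by move=> b p1 p2 s s' t _ IH; case/norP => n1 n2; apply: IH; case: ifP.
- by move=> b p s s1 s2 t1 t2 _ _ IH1 _ IH2 n; rewrite IH2 // IH1.
Qed.

Lemma run_rwrites p s s' t a :
  run inp p s s' t -> ~~ rwrites p a -> rmem s' a = rmem s a.
Proof.
elim=> {p s s' t} //=.
- by move=> b i e s nab; apply/funext => k; rewrite /upd (negPf nab).
- by move=> p1 p2 s s1 s2 t1 t2 _ IH1 _ IH2; case/norP => /IH1 <- /IH2.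
- by move=> b p1 p2 s s' t _ IH; case/norP => n1 n2; apply: IH; case: ifP.
- by move=> b p s s1 s2 t1 t2 _ _ IH1 _ IH2 n; rewrite IH2 // IH1.
Qed.

(** A total correctness triple with a time budget: the rules below compose postconditions and
    budgets together, so that each program is verified and costed in one pass. *)
Definition halts p s (c : nat) (Q : store R -> Prop) : Prop :=
  exists s' t, [/\ run inp p s s' t, (t <= c)%N & Q s'].

Lemma halts_le p s c c' (Q Q' : store R -> Prop) :
  halts p s c Q -> (c <= c')%N -> (forall s', Q s' -> Q' s') ->
  halts p s c' Q'.
Proof.
move=> [s' [t [r tc q]]] cc' QQ'; exists s', t; split=> //; last exact: QQ'.
exact: leq_trans cc'.
Qed.

Lemma halts_post p s c (Q Q' : store R -> Prop) :
  halts p s c Q -> (forall s', Q s' -> Q' s') -> halts p s c Q'.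
Proof. by move=> H; apply: halts_le H _. Qed.

Lemma halts_cost p s c c' (Q : store R -> Prop) :
  halts p s c Q -> (c <= c')%N -> halts p s c' Q.
Proof. by move=> H cc'; apply: halts_le H cc' _. Qed.

Lemma halts_frame p s c (Q : store R -> Prop) :
  halts p s c Q ->
  halts p s c (fun s' => [/\ Q s',
    forall a, ~~ iwrites p a -> imem s' a = imem s a &
    forall a, ~~ rwrites p a -> rmem s' a = rmem s a]).
Proof.
move=> [s' [t [r tc q]]]; exists s', t; split=> //; split=> // a.
  exact: run_iwrites r.
exact: run_rwrites r.
Qed.

Lemma halts_seq p1 p2 s c1 c2 (Q1 Q : store R -> Prop) :
  halts p1 s c1 Q1 -> (forall s1, Q1 s1 -> halts p2 s1 c2 Q) ->
  halts (Seq p1 p2) s (c1 + c2).+1 Q.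
Proof.
move=> [s1 [t1 [r1 l1 q1]]] H; have [s2 [t2 [r2 l2 q2]]] := H _ q1.
exists s2, (t1 + t2).+1; split=> //; first exact: run_seq r1 r2.
by rewrite ltnS leq_add.
Qed.

Lemma halts_skip s (Q : store R -> Prop) : Q s -> halts Skip s 1 Q.
Proof. by move=> q; exists s, 1%N; split=> //; exact: run_skip. Qed.

Lemma halts_iset a i e s (Q : store R -> Prop) :
  Q (Store (upd (imem s) a (ieval inp s i) (ieval inp s e)) (rmem s)) ->
  halts (ISet a i e) s (icost i + icost e).+1 Q.
Proof. by move=> q; eexists _, _; split; [exact: run_iset| |]. Qed.

Lemma halts_rset a i e s (Q : store R -> Prop) :
  Q (Store (imem s) (upd (rmem s) a (ieval inp s i) (reval inp s e))) ->
  halts (RSet a i e) s (icost i + rcost e).+1 Q.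
Proof. by move=> q; eexists _, _; split; [exact: run_rset| |]. Qed.

Lemma halts_if b p1 p2 s c1 c2 (Q : store R -> Prop) :
  (teval inp s b -> halts p1 s c1 Q) ->
  (~~ teval inp s b -> halts p2 s c2 Q) ->
  halts (If b p1 p2) s (tcost b + maxn c1 c2).+1 Q.
Proof.
move=> H1 H2.
have [s' [t [r l q]]] : halts (if teval inp s b then p1 else p2) s (maxn c1 c2) Q.
  case: ifP => [/H1|/negbT/H2] /halts_le; apply=> //.
    exact: leq_maxl.
  exact: leq_maxr.
by exists s', (tcost b + t).+1; split; [exact: run_if|rewrite ltnS leq_add2l|].
Qed.

                                                                              
                                     
(** The guard can hold only at invariant indices up to [B], hence the body runs at most [B.+1]
    times; the factor [B.+2] also pays for the final failing test. *)
Lemma halts_while b p s B cb (Inv : nat -> store R -> Prop) :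
  Inv 0%N s ->
  (forall j s1, Inv j s1 -> teval inp s1 b ->
     (j <= B)%N /\ halts p s1 cb (Inv j.+1)) ->
  halts (While b p) s (B.+2 * (tcost b + cb).+1)
    (fun s' => ~~ teval inp s' b /\ exists j, Inv j s').
Proof.
move=> I0 step.
suff H k : forall j s1, (j + k = B.+1)%N -> Inv j s1 ->
    halts (While b p) s1 (k.+1 * (tcost b + cb).+1)
    (fun s' => ~~ teval inp s' b /\ exists j, Inv j s') by exact: (H _ 0%N).
elim: k => [|k IH] j s1 jk Ij.
  have nb : ~~ teval inp s1 b.
    by apply/negP => /(step _ _ Ij)[jB _]; rewrite addn0 in jk; lia.
  exists s1, (tcost b).+1; split; [exact: run_while_stop| |by split=> //; exists j].
  by rewrite mul1n ltnS leq_addr.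
case: (boolP (teval inp s1 b)) => [bs|nb]; last first.
  exists s1, (tcost b).+1; split; [exact: run_while_stop| |by split=> //; exists j].
  by rewrite -addn1 mulSn; lia.
have [_ [s2 [t2 [r2 l2 I2]]]] := step _ _ Ij bs.
have [||s3 [t3 [r3 l3 I3]]] := IH j.+1 s2 => //; first lia.
exists s3, (tcost b + t2 + t3).+1; split=> //; first exact: run_while_step r2 r3.
by rewrite (mulSn k.+1); lia.
Qed.

End Runs.

                       

(** * Counting loops: pointwise assignment, accumulation and maximum *)

Definition LV : nat := 0.
Notation iz := (IConst 0).
Notation lv := (ILoad LV iz).

Definition For (e : iexp) (body : cmd) : cmd :=
  Seq (ISet LV iz iz)
      (While (ILe (IAdd lv (IConst 1)) e) (Seq body (ISet LV iz (IAdd lv (IConst 1))))).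

                                                 
(** This condition allows a loop writing the array [A] to be described by the store before the loop:
    [A] is read only at the index expression in [ie], and not at all for [None]. *)
Fixpoint reads_at (A : nat) (ie : option iexp) (e : rexp) : Prop :=
  match e with
  | RConst _ | RFile _ _ => True
  | RLoad a i => a <> A \/ Some i = ie
  | RAdd e1 e2 | RSub e1 e2 | RMul e1 e2 | RDiv e1 e2 =>
      reads_at A ie e1 /\ reads_at A ie e2
  end.

Section Loops.
Variables (R : realType) (inp : input R).
Implicit Types (s : store R) (p : cmd).

Definition at_loop s (k : nat) := Store (upd (imem s) LV 0 k) (rmem s).

Lemma ieval_imem s1 s2 e : imem s1 = imem s2 -> ieval inp s1 e = ieval inp s2 e.
Proof.
move=> eqm; elim: e => //=.
- by move=> f i ->.
- by move=> a i ->; rewrite eqm.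
- by move=> e1 -> e2 ->.
- by move=> e1 -> e2 ->.
Qed.

Lemma reval_reads A ie s1 s2 e :
  imem s1 = imem s2 -> (forall a, a <> A -> rmem s1 a = rmem s2 a) ->
  (forall i, Some i = ie -> rmem s1 A (ieval inp s1 i) = rmem s2 A (ieval inp s1 i)) ->
  reads_at A ie e -> reval inp s1 e = reval inp s2 e.
Proof.
move=> eqi eqr eqA; elim: e => //=.
- by move=> f i _; rewrite (ieval_imem _ eqi).
- move=> a i H; rewrite -(ieval_imem i eqi).
  case: (eqVneq a A) => [aA|/eqP aA]; last by rewrite eqr.
  by case: H => // H; rewrite aA; exact: eqA.
- by move=> e1 IH1 e2 IH2 [/IH1-> /IH2->].
- by move=> e1 IH1 e2 IH2 [/IH1-> /IH2->].
- by move=> e1 IH1 e2 IH2 [/IH1-> /IH2->].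
- by move=> e1 IH1 e2 IH2 [/IH1-> /IH2->].
Qed.

Definition for_cost (n : nat) (e : iexp) (cb : nat) : nat :=
  (n.+1 * (cb + icost e + 20))%N.

(** Bodies leave the index memory alone, so only the counter moves there and the invariant needs to
    speak of the real memory only. The bound [e] has the same value in every store. *)
Lemma halts_for e body n s cb (Inv : nat -> (nat -> nat -> R) -> Prop) :
  (forall s', ieval inp s' e = n) ->
  Inv 0%N (rmem s) ->
  (forall j s1, (j < n)%N -> imem s1 = upd (imem s) LV 0 j -> Inv j (rmem s1) ->
     halts inp body s1 cb (fun s2 => imem s2 = imem s1 /\ Inv j.+1 (rmem s2))) ->
  halts inp (For e body) s (for_cost n e cb)
    (fun s' => imem s' = upd (imem s) LV 0 n /\ Inv n (rmem s')).
Proof.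
move=> en I0 step.
pose s0 := at_loop s 0.
have updK (m : nat -> nat -> nat) x y : upd (upd m LV 0 x) LV 0 y = upd m LV 0 y.
  by apply/funext => a; apply/funext => i; rewrite /upd; case: (_ && _).
suff H k : forall j s1, (j + k = n)%N -> imem s1 = upd (imem s) LV 0 j ->
    Inv j (rmem s1) ->
    halts inp (While (ILe (IAdd lv (IConst 1)) e)
      (Seq body (ISet LV iz (IAdd lv (IConst 1))))) s1
      (k * (cb + icost e + 20) + (icost e + 6))
      (fun s' => imem s' = upd (imem s) LV 0 n /\ Inv n (rmem s')).
  have [s2 [t2 [r2 l2 q2]]] := H n 0%N s0 (add0n _) erefl I0.
  exists s2, (3 + t2).+1; split=> //.
    by apply: run_seq r2; exact: run_iset.
  rewrite /for_cost mulSn; lia.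
elim: k => [|k IH] j s1 jk m1 Ij.
  exists s1, (tcost (ILe (IAdd lv (IConst 1)) e)).+1; split=> //=; last 2 first.
  - lia.
  - by rewrite -jk addn0.
  by apply: run_while_stop; rewrite /= en m1 /upd /= addn1 -jk addn0 ltnn.
have jn : (j < n)%N by lia.
have [s2 [t2 [r2 l2 [m2 I2]]]] := step _ _ jn m1 Ij.
have [||s3 [t3 [r3 l3 q3]]] := IH j.+1 (Store (upd (imem s1) LV 0 j.+1) (rmem s2)) _ _ I2.
- lia.
- by rewrite /= m1 updK.
eexists s3, _; split; [|shelve|exact: q3].
apply: run_while_step; [| |exact: r3].
  by rewrite /= en m1 /upd /= addn1.
apply: run_seq; first exact: r2.
have -> : Store (upd (imem s1) LV 0 j.+1) (rmem s2) =
  Store (upd (imem s2) LV (ieval inp s2 iz) (ieval inp s2 (IAdd lv (IConst 1)))) (rmem s2).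
  have lvj : imem s1 LV 0 = j by rewrite m1 /upd eqxx.
  by rewrite /= m2 lvj addn1.
exact: run_iset.
Unshelve.
rewrite /= mulSn; lia.
Qed.

(** Reading [A] at the current cell is harmless: iteration [j] is the first to write cell [j], so it
    still sees the initial value. *)
Lemma halts_for_map e n A f s :
  (forall s', ieval inp s' e = n) -> reads_at A (Some lv) f ->
  halts inp (For e (RSet A lv f)) s (for_cost n e (rcost f + 3)) (fun s' =>
    [/\ imem s' = upd (imem s) LV 0 n, forall a, a <> A -> rmem s' a = rmem s a &
        forall j, (j < n)%N -> rmem s' A j = reval inp (at_loop s j) f]).
Proof.
move=> en rf.
pose Inv k (m : nat -> nat -> R) := [/\ forall a, a <> A -> m a = rmem s a,
  forall j, (j < k)%N -> m A j = reval inp (at_loop s j) f &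
  forall j, (k <= j)%N -> m A j = rmem s A j].
have I0 : Inv 0%N (rmem s) by [].
apply: halts_le (halts_for (Inv := Inv) en I0 _) _ _; last 2 first.
- exact: leqnn.
- by move=> s' [-> [? ? _]].
move=> j s1 jn m1 [I1 I2 I3].
apply: halts_le (halts_rset (Q := fun s2 => imem s2 = imem s1 /\ Inv j.+1 (rmem s2)) _) _ _ => //=; last by lia.
have lvj : imem s1 LV 0 = j by rewrite m1 /upd eqxx.
split=> //; split.
- move=> a aA; apply/funext => i; rewrite /upd; case: eqP => //= _; first by rewrite I1.
- move=> i; rewrite ltnS leq_eqVlt lvj /upd eqxx /=.
  case: (eqVneq i j) => [->|ij] /= ij2; last exact: I2.
  apply: (reval_reads (A := A) (ie := Some lv)) => //.
  by move=> _ [->] /=; rewrite lvj I3.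
- by move=> i ij; rewrite lvj /upd eqxx /= (gtn_eqF ij) I3 // ltnW.
Qed.

Lemma halts_for_sum e n A ie f s :
  (forall s', ieval inp s' e = n) -> reads_at A None f ->
  halts inp (For e (RSet A ie (RAdd (RLoad A ie) f))) s
    (for_cost n e (icost ie + icost ie + rcost f + 3)) (fun s' =>
    [/\ imem s' = upd (imem s) LV 0 n, forall a, a <> A -> rmem s' a = rmem s a &
        forall i, rmem s' A i = rmem s A i +
          \sum_(k < n | ieval inp (at_loop s k) ie == i) reval inp (at_loop s k) f]).
Proof.
move=> en rf.
pose Inv k (m : nat -> nat -> R) := (forall a, a <> A -> m a = rmem s a) /\
  forall i, m A i = rmem s A i +
     \sum_(k < k | ieval inp (at_loop s k) ie == i) reval inp (at_loop s k) f.
have I0 : Inv 0%N (rmem s) by split=> // i; rewrite big_ord0 addr0.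
apply: halts_le (halts_for (Inv := Inv) en I0 _) _ _; last 2 first.
- exact: leqnn.
- by move=> s' [-> [? ?]].
move=> j s1 jn m1 [I1 I2].
apply: halts_le (halts_rset (Q := fun s2 => imem s2 = imem s1 /\ Inv j.+1 (rmem s2)) _) _ _ => //=; last by lia.
have ie1 : ieval inp s1 ie = ieval inp (at_loop s j) ie by exact: ieval_imem.
have f1 : reval inp s1 f = reval inp (at_loop s j) f.
  exact: (reval_reads (A := A) (ie := None)).
split=> //; split.
- by move=> a aA; apply/funext => i; rewrite /upd; case: eqP => //= _; rewrite I1.
- move=> i; rewrite big_mkcond big_ord_recr -big_mkcond /= /upd eqxx /= ie1 f1 eq_sym.
  by case: eqP => [<-|_]; rewrite I2 ?addrA ?addr0.
Qed.

Lemma halts_for_max e n A f s :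
  (forall s', ieval inp s' e = n) -> reads_at A None f ->
  halts inp (For e (If (RLe (RLoad A iz) f) (RSet A iz f) Skip)) s
    (for_cost n e (rcost f + rcost f + 10)) (fun s' =>
    [/\ imem s' = upd (imem s) LV 0 n, forall a, a <> A -> rmem s' a = rmem s a,
        rmem s A 0 <= rmem s' A 0,
        forall j, (j < n)%N -> reval inp (at_loop s j) f <= rmem s' A 0 &
        rmem s' A 0 = rmem s A 0 \/
        exists2 j, (j < n)%N & rmem s' A 0 = reval inp (at_loop s j) f]).
Proof.
move=> en rf.
pose Inv k (m : nat -> nat -> R) := [/\ forall a, a <> A -> m a = rmem s a,
        rmem s A 0 <= m A 0,
        forall j, (j < k)%N -> reval inp (at_loop s j) f <= m A 0 &
        m A 0 = rmem s A 0 \/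
        exists2 j, (j < k)%N & m A 0 = reval inp (at_loop s j) f].
have I0 : Inv 0%N (rmem s) by split=> //; left.
apply: halts_le (halts_for (Inv := Inv) en I0 _) _ _; last 2 first.
- exact: leqnn.
- by move=> s' [-> [? ? ? ?]].
move=> j s1 jn m1 [I1 I2 I3 I4].
have f1 : reval inp s1 f = reval inp (at_loop s j) f.
  exact: (reval_reads (A := A) (ie := None)).
apply: (@halts_le _ _ _ _ _ _ _ _ (halts_if _ _) _ (fun _ => id)) => [b|b|]; last first.
- by instantiate (1 := 1%N); instantiate (1 := (rcost f + 2)%N) => /=; lia.
- apply: halts_skip; split=> //; split=> //.
    move=> i; rewrite ltnS leq_eqVlt => /orP[/eqP->|]; last exact: I3.
    by rewrite -f1; move: b => /=; rewrite -ltNge => /ltW.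
  by case: I4 => [|[i ij]]; [left|right; exists i => //; exact: ltnW].
- apply: halts_le (halts_rset (Q := fun s2 => imem s2 = imem s1 /\ Inv j.+1 (rmem s2)) _) _ _ => //=; last by lia.
  have ff : upd (rmem s1) A 0 (reval inp s1 f) A 0 = reval inp s1 f by rewrite /upd !eqxx.
  rewrite /= in b; split=> //; split=> //; rewrite ?ff.
  + by move=> a aA; apply/funext => i; rewrite /upd; case: eqP => //= _; rewrite I1.
  + exact: le_trans b.
  + move=> i; rewrite ltnS leq_eqVlt => /orP[/eqP->|]; first by rewrite f1.
    by move=> /I3 /le_trans; apply.
  + by right; exists j => //; rewrite f1.
Qed.

End Loops.

Arguments halts_for_map {R inp e n A f s}.
Arguments halts_for_sum {R inp e n A ie f s}.
Arguments halts_for_max {R inp e n A f s}.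

                             

                                                                           
                                                                            
(** * Embedding the oracle into a larger program by renaming files and arrays *)

Definition ifile_ren (f : nat) : nat := if (f < 2)%N then f else (f + 3)%N.
(** The files describing the cone keep their numbers. All other files are empty for the oracle, so
    they are shifted past the last file in use of the packing input and read as empty there too. *)
Definition rfile_ren (f : nat) : nat := if (f < 1)%N then f else (f + 4)%N.

Fixpoint iren (g : nat -> nat) (e : iexp) : iexp :=
  match e with
  | IConst k => IConst k
  | IFile f i => IFile (ifile_ren f) (iren g i)
  | ILoad a i => ILoad (g a) (iren g i)
  | IAdd e1 e2 => IAdd (iren g e1) (iren g e2)
  | ISub e1 e2 => ISub (iren g e1) (iren g e2)
  end.

Fixpoint rren (g h : nat -> nat) (e : rexp) : rexp :=
  match e with
  | RConst k => RConst k
  | RFile f i => RFile (rfile_ren f) (iren g i)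
  | RLoad a i => RLoad (h a) (iren g i)
  | RAdd e1 e2 => RAdd (rren g h e1) (rren g h e2)
  | RSub e1 e2 => RSub (rren g h e1) (rren g h e2)
  | RMul e1 e2 => RMul (rren g h e1) (rren g h e2)
  | RDiv e1 e2 => RDiv (rren g h e1) (rren g h e2)
  end.

Definition tren (g h : nat -> nat) (b : test) : test :=
  match b with
  | ILe e1 e2 => ILe (iren g e1) (iren g e2)
  | RLe e1 e2 => RLe (rren g h e1) (rren g h e2)
  end.

Fixpoint cren (g h : nat -> nat) (p : cmd) : cmd :=
  match p with
  | Skip => Skip
  | ISet a i e => ISet (g a) (iren g i) (iren g e)
  | RSet a i e => RSet (h a) (iren g i) (rren g h e)
  | Seq p1 p2 => Seq (cren g h p1) (cren g h p2)
  | If b p1 p2 => If (tren g h b) (cren g h p1) (cren g h p2)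
  | While b p1 => While (tren g h b) (cren g h p1)
  end.

Lemma icost_iren g e : icost (iren g e) = icost e.
Proof. by elim: e => //= [f i ->|a i ->|e1 -> e2 ->|e1 -> e2 ->]. Qed.

Lemma rcost_rren g h e : rcost (rren g h e) = rcost e.
Proof.
elim: e => //= [f i|a i|e1 -> e2 ->|e1 -> e2 ->|e1 -> e2 ->|e1 -> e2 ->] //.
all: by rewrite icost_iren.
Qed.

Lemma tcost_tren g h b : tcost (tren g h b) = tcost b.
Proof. by case: b => /= ? ?; rewrite ?icost_iren ?rcost_rren. Qed.

Lemma iwrites_cren g h p a : iwrites (cren g h p) a -> exists b, a = g b.
Proof.
elim: p => //= [b i e /eqP->|p1 IH1 p2 IH2 /orP[/IH1|/IH2]|b p1 IH1 p2 IH2 /orP[/IH1|/IH2]] //.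
by exists b.
Qed.

Lemma rwrites_cren g h p a : rwrites (cren g h p) a -> exists b, a = h b.
Proof.
elim: p => //= [b i e /eqP->|p1 IH1 p2 IH2 /orP[/IH1|/IH2]|b p1 IH1 p2 IH2 /orP[/IH1|/IH2]] //.
by exists b.
Qed.

Definition compatible_inputs (R : realType) (inpO inpQ : input R) : Prop :=
  (forall f, ifile inpQ (ifile_ren f) = ifile inpO f) /\
  (forall f, rfile inpQ (rfile_ren f) = rfile inpO f).

Section Renaming.
Variables (R : realType) (inpO inpQ : input R).
Hypothesis inpOQ : compatible_inputs inpO inpQ.
Variables (g h : nat -> nat).
Hypotheses (g_inj : injective g) (h_inj : injective h).

Definition view (s : store R) : store R :=
  Store (fun a => imem s (g a)) (fun a => rmem s (h a)).

Lemma ieval_iren s s' e : imem s' = (fun a => imem s (g a)) ->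
  ieval inpQ s (iren g e) = ieval inpO s' e.
Proof.
move=> s's; elim: e => //= [f i ->|a i ->|e1 -> e2 ->|e1 -> e2 ->] //.
  by rewrite inpOQ.1.
by rewrite s's.
Qed.

Lemma reval_rren s e : reval inpQ s (rren g h e) = reval inpO (view s) e.
Proof.
elim: e => //= [f i|a i|e1 -> e2 ->|e1 -> e2 ->|e1 -> e2 ->|e1 -> e2 ->] //.
  by rewrite inpOQ.2 (@ieval_iren _ (view s)).
by rewrite (@ieval_iren _ (view s)).
Qed.

Lemma teval_tren s b : teval inpQ s (tren g h b) = teval inpO (view s) b.
Proof. by case: b => /= ? ?; rewrite ?reval_rren ?(@ieval_iren _ (view s)). Qed.

(** Injectivity of the renamings keeps updates of distinct arrays distinct, so a run on the view
    lifts step by step, with the same running time. *)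
Lemma run_cren p s s' t : run inpO p (view s) s' t ->
  exists2 s1, run inpQ (cren g h p) s s1 t & s' = view s1.
Proof.
move vs: (view s) => v r; elim: r s vs => {p v s' t}.
- by move=> v s vs; exists s => //; exact: run_skip.
- move=> a i e v s <-; eexists.
    rewrite -(icost_iren g i) -(icost_iren g e); exact: run_iset.
  rewrite !(@ieval_iren _ (view s)) //; congr Store => /=.
  by apply/funext => a'; apply/funext => i'; rewrite /upd (inj_eq g_inj).
- move=> a i e v s <-; eexists.
    rewrite -(icost_iren g i) -(rcost_rren g h e); exact: run_rset.
  rewrite !(@ieval_iren _ (view s)) // reval_rren; congr Store => /=.
  by apply/funext => a'; apply/funext => i'; rewrite /upd (inj_eq h_inj).
- move=> p1 p2 v v1 v2 t1 t2 _ IH1 _ IH2 s /IH1[s1 r1 /esym/IH2[s2 r2 ->]].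
  by exists s2 => //; exact: run_seq r1 r2.
- move=> b p1 p2 v v' t _ IH s vs; have [s1 r1 ->] := IH _ vs.
  exists s1 => //; rewrite /= -(tcost_tren g h b); apply: run_if.
  by move: r1; rewrite teval_tren vs; case: ifP.
- move=> b p v nb s vs; exists s => //; rewrite -(tcost_tren g h b).
  by apply: run_while_stop; rewrite teval_tren vs.
- move=> b p v v1 v2 t1 t2 bv _ IH1 _ IH2 s vs.
  have [s1 r1 /esym/IH2[s2 r2 ->]] := IH1 _ vs.
  exists s2 => //; rewrite -(tcost_tren g h b).
  by apply: run_while_step r1 r2; rewrite teval_tren vs.
Qed.

End Renaming.

                              

                                                                           
                                                                              
                                                          
(** * Simulating a strongly combinatorial program on values affine in a parameter *)

Definition sim_int (a : nat) : nat := (3 * a + 2)%N.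
(** Memory is split by residues, modulo 3 for index arrays and modulo 4 for real arrays. Residue 0
    belongs to the algorithm itself, residue 1 to direct oracle calls, and the others to the
    simulated oracle, whose reals are stored as a constant part and a coefficient of the
    parameter. *)
Definition sim_cst (a : nat) : nat := (4 * a + 2)%N.
Definition sim_lin (a : nat) : nat := (4 * a + 3)%N.

Definition arrA : nat := 0.
Definition flag : nat := 3.
Definition cmpA : nat := 20.
Definition cmpB : nat := 24.

Section Simulation.
Variable dep : pred nat.

Notation iexp_sim := (iren sim_int).
Notation rexp_cst := (rren sim_int sim_cst).

(** The coefficient of the parameter in the value of [e]. In a product at most one factor depends on
    the query, so a single cross term survives; quotients are formed only from values independent of
    the query and contribute 0. *)
Fixpoint rexp_lin (e : rexp) : rexp :=
  match e with
  | RConst _ | RFile _ _ | RDiv _ _ => RConst 0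
  | RLoad a i => if dep a then RLoad (sim_lin a) (iexp_sim i) else RConst 0
  | RAdd e1 e2 => RAdd (rexp_lin e1) (rexp_lin e2)
  | RSub e1 e2 => RSub (rexp_lin e1) (rexp_lin e2)
  | RMul e1 e2 => if depends dep e2 then RMul (rexp_cst e1) (rexp_lin e2)
                  else RMul (rexp_lin e1) (rexp_cst e2)
  end.

Lemma rcost_rexp_lin e : (rcost (rexp_lin e) <= rcost e)%N.
Proof.
elim: e => //= [a i|e1 IH1 e2 IH2|e1 IH1 e2 IH2|e1 IH1 e2 IH2].
- by case: (dep a) => //=; rewrite icost_iren.
- by rewrite ltnS leq_add.
- by rewrite ltnS leq_add.
- by case: (depends _ _); rewrite /= rcost_rren ltnS leq_add.
Qed.

Variable resolve : cmd.

Definition sim_test (b : test) : cmd :=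
  match b with
  | ILe e1 e2 => If (ILe (iexp_sim e1) (iexp_sim e2))
      (ISet flag iz (IConst 1)) (ISet flag iz iz)
  | RLe e1 e2 =>
      Seq (RSet cmpA iz (RSub (rexp_cst e1) (rexp_cst e2)))
     (Seq (RSet cmpB iz (RSub (rexp_lin e1) (rexp_lin e2)))
          resolve)
  end.

Notation flag_set := (ILe (IConst 1) (ILoad flag iz)).

(** An assignment stores the linear part first, because [rexp_lin] may read constant parts whereas
    the expression for the constant part never reads linear ones. Each test leaves its verdict in
    [flag], and a loop therefore repeats its test at the end of the body. *)
Fixpoint sim (p : cmd) : cmd :=
  match p with
  | Skip => Skip
  | ISet a i e => ISet (sim_int a) (iexp_sim i) (iexp_sim e)
  | RSet a i e =>
      if dep a then Seq (RSet (sim_lin a) (iexp_sim i) (rexp_lin e))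
                        (RSet (sim_cst a) (iexp_sim i) (rexp_cst e))
      else RSet (sim_cst a) (iexp_sim i) (rexp_cst e)
  | Seq p1 p2 => Seq (sim p1) (sim p2)
  | If b p1 p2 => Seq (sim_test b) (If flag_set (sim p1) (sim p2))
  | While b p1 => Seq (sim_test b) (While flag_set (Seq (sim p1) (sim_test b)))
  end.

Lemma rwrites_sim p a : rwrites (sim p) a ->
  [\/ exists b, a = sim_cst b \/ a = sim_lin b, a = cmpA \/ a = cmpB | rwrites resolve a].
Proof.
have T b : rwrites (sim_test b) a -> (a = cmpA \/ a = cmpB) \/ rwrites resolve a.
  by case: b => e1 e2 //= => /orP[/eqP|/orP[/eqP|]]; [left; left|left; right|right].
elim: p => //= [b i e|p1 IH1 p2 IH2|b p1 IH1 p2 IH2|b p1 IH1].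
- case: ifP => _ /= => [/orP[]|] /eqP->; constructor 1; exists b; by [right|left].
- by case/orP => [/IH1|/IH2].
- by case/orP => [/T[]|/orP[/IH1|/IH2]] //; [constructor 2|constructor 3].
- by case/orP => [/T[]|/orP[/IH1|/T[]]] //; [constructor 2|constructor 3|constructor 2|constructor 3].
Qed.

Variables (R : realType) (inpO inpQ : input R).
Hypothesis inpOQ : compatible_inputs inpO inpQ.

(** The store that the oracle itself would have if the parameter had the concrete value [l]. *)
Definition instance (s : store R) (l : R) : store R :=
  Store (fun a => imem s (sim_int a))
    (fun a i => if dep a then rmem s (sim_cst a) i + l * rmem s (sim_lin a) i
                else rmem s (sim_cst a) i).

Lemma ieval_sim s l e : ieval inpQ s (iexp_sim e) = ieval inpO (instance s l) e.
Proof. exact: ieval_iren. Qed.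

Lemma rexp_lin_indep s e : ~~ depends dep e -> reval inpQ s (rexp_lin e) = 0.
Proof.
elim: e => //= [a i|e1 IH1 e2 IH2|e1 IH1 e2 IH2|e1 IH1 e2 IH2].
- by move=> /negPf->.
- by case/norP => /IH1-> /IH2->; rewrite addr0.
- by case/norP => /IH1-> /IH2->; rewrite subr0.
- by case/norP => /IH1 e10 /negPf->; rewrite /= e10 mul0r.
Qed.

Lemma reval_sim s l e : combinatorial_rexp dep e ->
  reval inpO (instance s l) e =
  reval inpQ s (rexp_cst e) + l * reval inpQ s (rexp_lin e).
Proof.
elim: e => //= [k|f i|a i|e1 IH1 e2 IH2|e1 IH1 e2 IH2|e1 IH1 e2 IH2|e1 IH1 e2 IH2].
- by rewrite mulr0 addr0.
- by rewrite mulr0 addr0 inpOQ.2 (ieval_sim s l).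
- move=> _; rewrite (ieval_sim s l).
  by case: (dep a); rewrite ?mulr0 ?addr0 //= (ieval_sim s l).
- by case/andP => /IH1-> /IH2->; rewrite mulrDr addrACA.
- by case/andP => /IH1-> /IH2->; rewrite mulrBr opprD addrACA.
- case/and3P => /IH1-> /IH2->; rewrite negb_and => /orP[nd|nd].
    rewrite (rexp_lin_indep _ nd) mulr0 addr0 mulrDr.
    case: ifPn => [_|nd2] /=; first by rewrite mulrCA.
    by rewrite (rexp_lin_indep _ nd) (rexp_lin_indep _ nd2) !(mul0r, mulr0).
  by rewrite (negPf nd) /= (rexp_lin_indep _ nd) mulr0 addr0 mulrDl mulrA.
- case/and3P => /IH1-> /IH2->; rewrite negb_or => /andP[nd1 nd2].
  by rewrite (rexp_lin_indep _ nd1) (rexp_lin_indep _ nd2) !mulr0 !addr0.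
Qed.

Lemma instance_eq s s' l :
  (forall a, imem s' (sim_int a) = imem s (sim_int a)) ->
  (forall a, rmem s' (sim_cst a) = rmem s (sim_cst a)) ->
  (forall a, rmem s' (sim_lin a) = rmem s (sim_lin a)) ->
  instance s' l = instance s l.
Proof.
move=> e1 e2 e3; congr Store; first by apply/funext => a; rewrite e1.
by apply/funext => a; apply/funext => i; rewrite e2 e3.
Qed.

(** The filter [Fl] stands for the undetermined parameter: a comparison counts as decided once its
    outcome is the same on a set of values [l] belonging to [Fl]. *)
Variables (Fl : set_system R) (fA : nat -> R) (cR : nat).
Context {FF : ProperFilter Fl}.

Hypothesis resolve_ok : forall s, rmem s arrA = fA ->
  halts inpQ resolve s cR (fun s' =>
    [/\ rmem s' arrA = fA,
        forall l, instance s' l = instance s l &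
        Fl [set l | (rmem s cmpA 0 + l * rmem s cmpB 0 <= 0) =
                    (0 < imem s' flag 0)%N]%classic]).

Lemma sim_test_ok b s : combinatorial_test dep b -> rmem s arrA = fA ->
  halts inpQ (sim_test b) s (cR + 4 * tcost b + 10) (fun s' =>
    [/\ rmem s' arrA = fA,
        forall l, instance s' l = instance s l &
        Fl [set l | teval inpO (instance s l) b = (0 < imem s' flag 0)%N]%classic]).
Proof.
case: b => e1 e2 /=.
  move=> _ As; apply: (@halts_le _ _ _ _ _ _ _ _ (halts_if _ _) _ (fun _ => id)) => [b|b|].
  - apply: halts_iset => /=; split=> //.
      by move=> l; apply: instance_eq => //= a; apply/funext => i; rewrite /upd /sim_int /flag; case: eqP => //; lia.
    apply: filterS filterT => l _ /=; move: b => /=.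
    by rewrite !(ieval_sim s l) => ->.
  - apply: halts_iset => /=; split=> //.
      by move=> l; apply: instance_eq => //= a; apply/funext => i; rewrite /upd /sim_int /flag; case: eqP => //; lia.
    apply: filterS filterT => l _ /=; move: b => /=.
    by rewrite !(ieval_sim s l) => /negPf->.
  - by rewrite /= !icost_iren; lia.
move=> /andP[c1 c2] As.
pose s1 := Store (imem s) (upd (rmem s) cmpA 0 (reval inpQ s (RSub (rexp_cst e1) (rexp_cst e2)))).
pose s2 := Store (imem s1) (upd (rmem s1) cmpB 0 (reval inpQ s1 (RSub (rexp_lin e1) (rexp_lin e2)))).
have i1 l : instance s1 l = instance s l.
  by apply: instance_eq => //= a; apply/funext => i; rewrite /upd /sim_cst /sim_lin /cmpA; case: eqP => //; lia.
have i2 l : instance s2 l = instance s l.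
  by rewrite -i1; apply: instance_eq => //= a; apply/funext => i; rewrite /upd /sim_cst /sim_lin /cmpB; case: eqP => //; lia.
have As2 : rmem s2 arrA = fA by [].
have lin1 e : reval inpQ s1 (rexp_lin e) = reval inpQ s (rexp_lin e).
  have cst1 e' : reval inpQ s1 (rexp_cst e') = reval inpQ s (rexp_cst e').
    rewrite !(reval_rren inpOQ); congr reval; congr Store.
    by apply/funext => a; apply/funext => i; rewrite /= /upd /sim_cst /cmpA; case: eqP => //; lia.
  elim: e => //= [a i|? -> ? ->|? -> ? ->|? IH1 ? IH2] //.
    case: (dep a) => //=; rewrite (@ieval_imem _ _ s1 s) //=.
    by rewrite /upd /sim_lin /cmpA; case: eqP => //; lia.
  by case: ifP => /= _; rewrite cst1 ?IH1 ?IH2.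
have [s3 [t3 [r3 l3 [A3 i3 f3]]]] := resolve_ok As2.
eexists s3, _; split; [| |split=> //].
- by apply: run_seq; [exact: run_rset|apply: run_seq; [exact: run_rset|exact: r3]].
- rewrite /= !rcost_rren.
  have := rcost_rexp_lin e1; have := rcost_rexp_lin e2; lia.
- by move=> l; rewrite i3 i2.
- apply: filterS f3 => l /= <-.
  rewrite (reval_sim _ _ c1) (reval_sim _ _ c2) /upd /= !lin1.
  rewrite -subr_le0 opprD addrACA -mulrBr; congr (_ <= _).
Qed.

Let W := (cR + 20)%N.

(** A run makes finitely many tests, and each is decided uniformly on a member of [Fl]; the
    intersection of these members is again in [Fl], and on it all concrete runs follow the simulated
    path. The induction is on the step bound [B] common to the concrete runs, which also covers
    loops. One concrete step is paid for by [W], the cost of resolving a comparison plus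
    overhead. *)
Lemma sim_ok B p s : combinatorial_cmd dep p -> rmem s arrA = fA ->
  Fl [set l | exists s' t, run inpO p (instance s l) s' t /\ (t <= B)%N]%classic ->
  exists s' t' t, [/\ run inpQ (sim p) s s' t', (t' <= W * t)%N, rmem s' arrA = fA &
    Fl [set l | run inpO p (instance s l) (instance s' l) t]%classic].
Proof.
elim/ltn_ind: B p s => B IH p s; case: p => /=.
- move=> _ As _; exists s, 1%N, 1%N; split=> //; [exact: run_skip|by rewrite /W; lia|].
  apply: filterS filterT => l _ /=; exact: run_skip.
- move=> a i e _ As _; eexists _, _, (icost i + icost e).+1; split.
  + exact: run_iset.
  + by rewrite !icost_iren /W; nia.
  + by [].
  + apply: filterS filterT => l _ /=.
    set s' := Store _ _.
    have -> : instance s' l =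
      Store (upd (imem (instance s l)) a (ieval inpO (instance s l) i) (ieval inpO (instance s l) e)) (rmem (instance s l)).
      rewrite /s' /instance /=; congr Store; apply/funext => a'; apply/funext => i'.
      rewrite /upd !(ieval_sim s l) /sim_int eqn_add2r eqn_pmul2l //.
    exact: run_iset.
- move=> a i e /andP[ce /implyP de] As _.
  case: ifPn => da; last first.
    eexists _, _, (icost i + rcost e).+1; split.
    + exact: run_rset.
    + by rewrite !icost_iren rcost_rren /W; nia.
    + by rewrite -As; apply/funext => k; rewrite /= /upd /arrA /sim_cst; case: eqP => //; lia.
    + apply: filterS filterT => l _ /=.
      set s' := Store _ _.
      have -> : instance s' l =
        Store (imem (instance s l)) (upd (rmem (instance s l)) a (ieval inpO (instance s l) i) (reval inpO (instance s l) e)).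
        rewrite /s' /instance /=; congr Store; apply/funext => a'; apply/funext => i'.
        rewrite (reval_sim _ _ ce) rexp_lin_indep; last by apply/negP => /de; rewrite (negPf da).
        rewrite mulr0 addr0 /upd !(ieval_sim s l) /sim_cst /sim_lin eqn_add2r eqn_pmul2l //.
        case: (eqVneq a' a) => [->|aa'] /=; first by rewrite (negPf da); case: eqP.
        by case: (dep a') => //; case: eqP => //=; lia.
      exact: run_rset.
  pose s1 := Store (imem s) (upd (rmem s) (sim_lin a) (ieval inpQ s (iexp_sim i)) (reval inpQ s (rexp_lin e))).
  have cst1 : reval inpQ s1 (rexp_cst e) = reval inpQ s (rexp_cst e).
    rewrite !(reval_rren inpOQ); congr reval; congr Store.
    by apply/funext => a'; apply/funext => i'; rewrite /= /upd /sim_cst /sim_lin; case: eqP => //; lia.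
  eexists _, _, (icost i + rcost e).+1; split.
  + by apply: run_seq; [exact: run_rset|exact: run_rset].
  + rewrite !icost_iren rcost_rren /W; have := rcost_rexp_lin e; nia.
  + rewrite -As; apply/funext => k; rewrite /= /upd /arrA /sim_cst /sim_lin.
    by case: eqP => //=; [lia|case: eqP => //; lia].
  + apply: filterS filterT => l _ /=.
    set s' := Store _ _.
    have -> : instance s' l =
      Store (imem (instance s l)) (upd (rmem (instance s l)) a (ieval inpO (instance s l) i) (reval inpO (instance s l) e)).
      rewrite /s' -/s1 /instance /=; congr Store; apply/funext => a'; apply/funext => i'.
      rewrite (reval_sim _ _ ce) cst1 /upd !(ieval_sim s l) (ieval_sim s1 l) /sim_cst /sim_lin !eqn_add2r !eqn_pmul2l //.
      have -> : ieval inpO (instance s1 l) i = ieval inpO (instance s l) i by exact: ieval_imem.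
      have -> : (4 * a' + 2 == 4 * a + 3)%N = false by apply/eqP; lia.
      have -> : (4 * a' + 3 == 4 * a + 2)%N = false by apply/eqP; lia.
      case: (eqVneq a' a) => [->|aa'] //=; rewrite da.
      by case: eqP.
    exact: run_rset.
- move=> p1 p2 /andP[cp1 cp2] As H.
  (* Members of a proper filter are inhabited; one concrete run shows that [B] is positive, so the
     induction hypothesis applies to [B.-1]. *)
  have /filter_ex[l0 [_ [_ [/run_inv[_ [t1 [t2 [/run_gt0 t1p _ ->]]]] tB]]]] := H.
  have B0 : (B.-1 < B)%N by lia.
  have [|s1 [u1 [v1 [r1 l1 A1 H1]]]] := IH _ B0 p1 s cp1 As.
    apply: filterS H => l [s' [t [/run_inv[s1 [w1 [w2 [q1 _ ->]]]] wB]]].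
    by exists s1, w1; split=> //; lia.
  have [|s2 [u2 [v2 [r2 l2 A2 H2]]]] := IH _ B0 p2 s1 cp2 A1.
    apply: filterS2 H H1 => l [s' [t [/run_inv[s1' [w1 [w2 [q1 q2 ->]]]] wB]]] q1'.
    (* Determinism identifies the intermediate store of the assumed run with the one reached by the
       simulation. *)
    have [? ?] := run_det q1 q1'; subst.
    by exists s', w2; split=> //; lia.
  exists s2, (u1 + u2).+1, (v1 + v2).+1; split=> //; first exact: run_seq r1 r2.
    by rewrite mulnS mulnDr; lia.
  by apply: filterS2 H1 H2 => l; exact: run_seq.
- move=> b p1 p2 /and3P[cb cp1 cp2] As H.
  have [s0 [u0 [r0 l0 [A0 i0 H0]]]] := sim_test_ok cb As.
  have /filter_ex[_ [_ [_ [/run_inv[t1 /run_gt0 t1p ->] tB]]]] := H.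
  have B0 : (B.-1 < B)%N by lia.
  pose q := if (0 < imem s0 flag 0)%N then p1 else p2.
  have cq : combinatorial_cmd dep q by rewrite /q; case: ifP.
  have [|s1 [u1 [v1 [r1 l1 A1 H1]]]] := IH _ B0 q s0 cq A0.
    apply: filterS2 H H0 => l [s' [t [/run_inv[w1 q1 ->] wB]]] tl.
    by rewrite /= i0; exists s', w1; split; [rewrite /q -tl|lia].
  have tb : (0 < tcost b)%N by case: (b).
  eexists s1, _, (tcost b + v1).+1; split.
  + apply: run_seq; first exact: r0.
    apply: run_if; rewrite /=.
    by move: r1; rewrite /q; case: ifP => _; exact.
  + by rewrite /= mulnS mulnDr; rewrite /W in l1 *; nia.
  + exact: A1.
  + apply: filterS2 H0 H1 => l tl; rewrite /= i0 => q1.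
    by apply: run_if; rewrite tl.
- move=> b p1 /andP[cb cp1] As H.
  have tb : (0 < tcost b)%N by case: (b).
  have [s0 [u0 [r0 l0 [A0 i0 H0]]]] := sim_test_ok cb As.
  have /filter_ex[l9 [s9 [t1 [/run_gt0 t1p tB]]]] := H.
  have B0 : (B.-1 < B)%N by lia.
  case: (posnP (imem s0 flag 0)) => fl.
    eexists s0, _, (tcost b).+1; split.
    + apply: run_seq; first exact: r0.
      by apply: run_while_stop; rewrite /= fl.
    + by rewrite /= /W; nia.
    + exact: A0.
    + apply: filterS H0 => l /=; rewrite fl i0 => tl.
      by apply: run_while_stop; rewrite tl.
  have [|s1 [u1 [v1 [r1 l1 A1 H1]]]] := IH _ B0 p1 s0 cp1 A0.
    apply: filterS2 H H0 => l [s' [t [/run_inv q wB]]] tl.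
    move: q; rewrite tl fl => -[s1 [w1 [w2 [q1 _ E]]]].
    by rewrite /= i0; exists s1, w1; split=> //; lia.
  have cw : combinatorial_cmd dep (While b p1) by rewrite /= cb.
  have [|s2 [u2 [v2 [r2 l2 A2 H2]]]] := IH _ B0 (While b p1) s1 cw A1.
    apply: (filterS3 _ _ H H0 H1) => l [s' [t [/run_inv q wB]]] tl q1'.
    move: q; rewrite tl fl => -[s1' [w1 [w2 [q1 q2 E]]]].
    move: q1'; rewrite /= i0 => q1'; have [? ?] := run_det q1 q1'; subst.
    by exists s', w2; split=> //; lia.
  have /run_inv[s1' [x1 [x2 [y1 y2 E]]]] := r2.
  eexists s2, _, (tcost b + v1 + v2).+1; split.
  + apply: run_seq; first exact: r0.
    apply: run_while_step; [exact: fl| |exact: y2].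
    by apply: run_seq; [exact: r1|exact: y1].
  + by rewrite /= mulnS !mulnDr; rewrite /W in l1 l2 *; nia.
  + exact: A2.
  + apply: (filterS3 _ _ H0 H1 H2) => l tl; rewrite /= i0 => q1 q2.
    by apply: run_while_step q1 q2; rewrite tl.
Qed.

End Simulation.

                                                

                                                                            
                                                    
(** * Parametric search: comparisons are resolved by calls of the oracle *)

Definition orc_int (a : nat) : nat := (3 * a + 1)%N.
Definition orc_real (a : nat) : nat := (4 * a + 1)%N.
Definition lamA : nat := 28.

Notation nE := (IFile 1 iz).
Notation lamE := (RLoad lamA iz).
Notation cE := (RFile 3 lv).

Definition query (P : cmd) : cmd :=
  Seq (For nE (RSet (orc_real 0) lv (RSub (RMul lamE (RLoad arrA lv)) cE)))
      (cren orc_int orc_real P).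

Definition query_ok_test : test := ILe (ILoad (orc_int 0) iz) iz.

(** Decides whether [A + l B <= 0], with [A] and [B] in [cmpA] and [cmpB], for [l] just below the
    critical value. If [B] is nonzero, only the side of the root [- A / B] matters. An oracle call
    at the root that finds no violation places [l] below it, and a violation places [l] above it;
    the sign of [B] decides which flag goes with which side. *)
Definition resolve (P : cmd) : cmd :=
  let set_flag k := ISet flag iz (IConst k) in
  let root := RSet lamA iz (RDiv (RSub (RConst 0) (RLoad cmpA iz)) (RLoad cmpB iz)) in
  If (RLe (RLoad cmpB iz) (RConst 0))
    (If (RLe (RConst 0) (RLoad cmpB iz))
      (If (RLe (RLoad cmpA iz) (RConst 0)) (set_flag 1) (set_flag 0))
      (Seq root (Seq (query P) (If query_ok_test (set_flag 0) (set_flag 1)))))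
    (Seq root (Seq (query P) (If query_ok_test (set_flag 1) (set_flag 0)))).

Lemma compatible_packing_input (R : realType) (J : packing R) (eps : R) :
  compatible_inputs (oracle_input (pcone J)) (packing_input J eps).
Proof. by split=> -[|[|f]] //=; rewrite /ifile_ren /rfile_ren /= ?addn3 ?addn4. Qed.

Lemma nth_map_enum_ord (T : Type) (x0 : T) n (f : 'I_n -> T) (j : 'I_n) :
  nth x0 [seq f i | i <- enum 'I_n] j = f j.
Proof. by rewrite (nth_map j) ?size_enum_ord // nth_ord_enum. Qed.

Lemma exists_argmax (R : realType) (T : eqType) (f : T -> R) (s : seq T) :
  s != [::] -> exists2 x, x \in s & forall z, z \in s -> f z <= f x.
Proof.
elim: s => // x [|y s] IH _.
  by exists x => [|z]; rewrite mem_seq1 ?eqxx // => /eqP->.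
have [//|w ws wmax] := IH; have [fx|fx] := leP (f x) (f w).
  by exists w => [|z]; rewrite inE ?ws ?orbT // => /orP[/eqP->|/wmax].
exists x => [|z]; rewrite inE ?eqxx // => /orP[/eqP->//|/wmax fz].
exact: le_trans fz (ltW fx).
Qed.

                                                                                 
(** With a nonzero slope the map would be injective and take more values on the interval than [s]
    has entries. *)
Lemma affine_finite_range (R : realType) (u v a b : R) (s : seq R) : a < b ->
  (forall l, a < l < b -> u + l * v \in s) -> v = 0.
Proof.
move=> ab H; apply/eqP; apply/negPn/negP => v0.
(* Infinitely many distinct points of the open interval; the denominator starts at 2 because 1 would
   give the excluded endpoint [a]. *)
pose l (i : nat) := b - (b - a) / i.+2%:R.
have linj : injective l.
  move=> i j /addrI/oppr_inj/mulfI; rewrite subr_eq0 gt_eqF // => /(_ isT)/invr_inj/eqP.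
  by rewrite eqr_nat => /eqP[].
have lab i : a < l i < b.
  have i2 : 1 < i.+2%:R :> R by rewrite ltr1n.
  have ba : 0 < b - a by rewrite subr_gt0.
  have h1 : 0 < (b - a) / i.+2%:R by rewrite divr_gt0 // ltr0n.
  have h2 : (b - a) / i.+2%:R < b - a by rewrite ltr_pdivrMr ?ltr0n // ltr_pMr.
  by rewrite /l; move: h1 h2; set w := _ / _ => h1 h2; apply/andP; split; lra.
have : leq (size [seq u + l i * v | i <- iota 0 (size s).+1]) (size s).
  apply: uniq_leq_size => [|_ /mapP[i _ ->]]; last exact: H.
  by rewrite map_inj_uniq ?iota_uniq // => i j /addrI/(mulIf v0)/linj.
by rewrite size_map size_iota ltnn.
Qed.

Section LeftGerm.
Variable R : realType.

(** Parameters just below [lam]. They are strictly below because at the critical value itself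
    nothing is violated and the oracle would return no vector. *)
Definition left_germ (lam : R) : set_system R :=
  [set Q : set R | exists2 a, a < lam & forall l, a < l < lam -> Q l]%classic.

(** Serves the case of an empty [S], which has no critical value: no query is ever violated, and
    parameters near minus infinity lie below any given root, as [resolve] then concludes. *)
Definition minfty_germ : set_system R :=
  [set Q : set R | exists a, forall l, l < a -> Q l]%classic.

Lemma left_germ_proper lam : ProperFilter (left_germ lam).
Proof.
constructor.
  by move=> [a al /(_ ((a + lam) / 2))]; apply; rewrite midf_lt //=; lra.
constructor.
- by exists (lam - 1) => //; rewrite ltrBlDr ltrDl.
- move=> A B [a al Aa] [b bl Bb]; exists (Num.max a b); first by rewrite gt_max al.
  by move=> l; rewrite gt_max => /andP[/andP[la lb] ll]; split; [apply: Aa|apply: Bb]; rewrite ?la ?lb.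
- by move=> A B AB [a al Aa]; exists a => // l /Aa/AB.
Qed.

Lemma minfty_germ_proper : ProperFilter minfty_germ.
Proof.
constructor.
  by move=> [a /(_ (a - 1))]; apply; lra.
constructor.
- by exists 0.
- move=> A B [a Aa] [b Bb]; exists (Num.min a b) => l.
  by rewrite lt_min => /andP[/Aa ? /Bb].
- by move=> A B AB [a Aa]; exists a => l /Aa/AB.
Qed.
End LeftGerm.

Section DotProduct.
Variables (R : realType) (n : nat).
Implicit Types (u v x : 'cV[R]_n).

Lemma dotpBl u v x : dotp (u - v) x = dotp u x - dotp v x.
Proof. by rewrite /dotp -sumrB; apply: eq_bigr => j _; rewrite !mxE mulrBl. Qed.

Lemma dotpZl k u x : dotp (k *: u) x = k * dotp u x.
Proof. by rewrite /dotp mulr_sumr; apply: eq_bigr => j _; rewrite !mxE mulrA. Qed.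

Lemma dotp_gt0 u x : (forall j, 0 < u j 0) -> x != 0 -> (forall j, 0 <= x j 0) ->
  0 < dotp u x.
Proof.
move=> u0 xn0 x0; rewrite lt_neqAle sumr_ge0 ?andbT; last first.
  by move=> j _; rewrite mulr_ge0 // ltW.
apply: contraNneq xn0 => /esym/psumr_eq0P E.
apply/eqP/matrixP => j k; rewrite !ord1 mxE.
have /eqP := E (fun j _ => mulr_ge0 (ltW (u0 j)) (x0 j)) j isT.
by rewrite mulf_eq0 gt_eqF //= => /eqP.
Qed.

End DotProduct.

Section ParametricSearch.
Variables (R : realType) (F : cone_inst R -> Prop) (P : cmd) (T : cone_inst R -> nat).
Hypothesis gens_nonneg : forall I, F I -> gens_ok I.
Hypothesis P_oracle : separation_oracle F P T.
Variables (J : packing R) (eps : R).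
Hypothesis FJ : F (pcone J).

Notation inpO := (oracle_input (pcone J)).
Notation inpQ := (packing_input J eps).
Notation n := (cone_dim (pcone J)).
Notation S := (gens (pcone J)).
Notation T_J := (T (pcone J)).

Definition cvec : 'cV[R]_n := map_mx intr (vecc J).

Lemma eval_nE s : ieval inpQ s nE = n. Proof. by []. Qed.

Lemma nth_cvec (j : 'I_n) : nth 0 (rfile inpQ 3) j = cvec j 0.
Proof. by rewrite /= nth_map_enum_ord mxE. Qed.

Definition query_cost : nat := (n.+1 * 35 + T_J + 1)%N.

Lemma query_ok s (d : 'cV[R]_n) :
  (forall j : 'I_n, d j 0 = rmem s lamA 0 * rmem s arrA j - cvec j 0) ->
  halts inpQ (query P) s query_cost (fun s' =>
   [/\ forall a, (forall b, a <> orc_real b) -> rmem s' a = rmem s a,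
       forall a, (forall b, a <> orc_int b) -> a <> LV -> imem s' a = imem s a &
       if imem s' (orc_int 0) 0 == 0%N then forall x, x \in S -> 0 <= dotp d x
       else exists x, [/\ x \in S, dotp d x < 0 & holds_vec s' (orc_real 1) x]]).
Proof.
move=> dE.
apply: (@halts_le _ _ _ _ _ _ _ _ (halts_seq (halts_for_map eval_nE _) _) _ (fun _ => id)) => /=.
- by split=> //; split=> //; left.
- move=> s1 [i1 f1 v1].
  have hd : holds_vec (view orc_int orc_real s1) 0 d.
    by move=> j; rewrite /= v1 //= dE -nth_cvec /at_loop /= /upd eqxx.
  have [s' [t [r tT E]]] := P_oracle FJ hd.
  have g_inj : injective orc_int by move=> x y; rewrite /orc_int; lia.
  have h_inj : injective orc_real by move=> x y; rewrite /orc_real; lia.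
  have [s2 r2 s'E] := run_cren (compatible_packing_input J eps) g_inj h_inj r.
  exists s2, t; split=> //; first exact: tT.
  split.
  + move=> a na; rewrite (run_rwrites r2); first by rewrite f1 //; exact: na.
    by apply/negP => /rwrites_cren[b]; exact: na.
  + move=> a na aLV; rewrite (run_iwrites r2) ?i1.
      by apply/funext => k; rewrite /upd; case: eqP.
    by apply/negP => /iwrites_cren[b]; exact: na.
  + by move: E; rewrite s'E.
- by rewrite /for_cost /query_cost /=; lia.
Qed.

Variables (dep : pred nat) (av : 'cV[R]_n) (fA : nat -> R).
Hypothesis dep0 : dep 0%N.
Hypothesis P_comb : combinatorial_cmd dep P.
Hypothesis fA_av : forall j : 'I_n, fA j = av j 0.
Hypothesis av_gt0 : forall j, 0 < av j 0.

Let par (l : R) : 'cV[R]_n := l *: av - cvec.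

Lemma dotp_par l x : dotp (par l) x = l * dotp av x - dotp cvec x.
Proof. by rewrite /par dotpBl dotpZl. Qed.

Section Resolve.
Variables (Fl : set_system R).
Context {FF : ProperFilter Fl}.
Hypothesis Fl_ok : forall l0,
  (forall x, x \in S -> 0 <= dotp (par l0) x) -> Fl [set l | l < l0]%classic.
Hypothesis Fl_viol : forall l0 x,
  x \in S -> dotp (par l0) x < 0 -> Fl [set l | l0 < l]%classic.

Lemma resolve_ok s : rmem s arrA = fA ->
  halts inpQ (resolve P) s (query_cost + 60) (fun s' =>
    [/\ rmem s' arrA = fA,
        forall l, instance dep s' l = instance dep s l &
        Fl [set l | (rmem s cmpA 0 + l * rmem s cmpB 0 <= 0) =
                    (0 < imem s' flag 0)%N]%classic]).
Proof.
move=> As.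
set A := rmem s cmpA 0; set B := rmem s cmpB 0.
pose l0 := - A / B.
have set_flag s1 k : (forall l, instance dep s1 l = instance dep s l) ->
   rmem s1 arrA = fA ->
   Fl [set l | (A + l * B <= 0) = (0 < k)%N]%classic ->
   halts inpQ (ISet flag iz (IConst k)) s1 3 (fun s' =>
    [/\ rmem s' arrA = fA,
        forall l, instance dep s' l = instance dep s l &
        Fl [set l | (A + l * B <= 0) = (0 < imem s' flag 0)%N]%classic]).
  move=> is1 A1 H; apply: halts_iset; split=> //= l; rewrite -is1.
  by apply: instance_eq => // a; apply/funext => i; rewrite /= /upd /sim_int /flag; case: eqP => //; lia.
(* Shared by both signs of [B]: [k1] is the verdict for parameters below the root, [k2] the one for
   parameters above it. *)
have call k1 k2 :
   (Fl [set l | l < l0]%classic -> Fl [set l | (A + l * B <= 0) = (0 < k1)%N]%classic) ->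
   (Fl [set l | l0 < l]%classic -> Fl [set l | (A + l * B <= 0) = (0 < k2)%N]%classic) ->
   halts inpQ (Seq (RSet lamA iz (RDiv (RSub (RConst 0) (RLoad cmpA iz)) (RLoad cmpB iz)))
      (Seq (query P) (If query_ok_test (ISet flag iz (IConst k1)) (ISet flag iz (IConst k2))))) s (query_cost + 30)
     (fun s' =>
    [/\ rmem s' arrA = fA,
        forall l, instance dep s' l = instance dep s l &
        Fl [set l | (A + l * B <= 0) = (0 < imem s' flag 0)%N]%classic]).
  move=> H1 H2.
  pose s1 := Store (imem s) (upd (rmem s) lamA 0 l0).
  apply: (@halts_le _ _ _ _ _ _ _ _ (@halts_seq _ _ _ _ _ _ _ (eq^~ s1) _ (halts_rset _) _) _ (fun _ => id)).
  - by rewrite /s1 /= sub0r.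
  - move=> _ ->.
    have p0 (j : 'I_n) : par l0 j 0 = rmem s1 lamA 0 * rmem s1 arrA j - cvec j 0.
      rewrite /s1 /= -[upd _ _ _ _ lamA 0]/l0 -[upd _ _ _ _ arrA j]/(rmem s arrA j).
      by rewrite As fA_av !mxE.
    apply: (halts_seq (query_ok p0)) => s2 [f2 i2 E2].
    have is2 l : instance dep s2 l = instance dep s l.
      apply: instance_eq => a.
      + by rewrite i2 // => [b|]; rewrite /orc_int /sim_int /LV; lia.
      + rewrite f2; last by move=> b; rewrite /orc_real /sim_cst; lia.
        by apply/funext => k; rewrite /= /upd /sim_cst /lamA; case: eqP => //; lia.
      + rewrite f2; last by move=> b; rewrite /orc_real /sim_lin; lia.
        by apply/funext => k; rewrite /= /upd /sim_lin /lamA; case: eqP => //; lia.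
    have As2 : rmem s2 arrA = fA.
      by rewrite f2 // => b; rewrite /orc_real /arrA; lia.
    apply: halts_if => /=; rewrite leqn0 => E; move: E2.
    + rewrite E => E2; apply: set_flag => //; apply: H1; exact: Fl_ok.
    + rewrite (negPf E) => -[x [xS x0 _]]; apply: set_flag => //; apply: H2; exact: Fl_viol x0.
  - by rewrite /=; lia.
have AlB l : B != 0 -> A + l * B = (l - l0) * B.
  by move=> B0; rewrite /l0; field.
apply: (@halts_le _ _ _ _ _ _ _ _ (halts_if _ _) _ (fun _ => id)) => /=; rewrite -/B.
- move=> B0; apply: halts_if => /=; rewrite -/B => B1.
    have {B0 B1} B0 : B = 0 by apply/eqP; rewrite eq_le B0.
    apply: halts_if => /=; rewrite -/A => A0; apply: set_flag => //.
    + by apply: filterS filterT => l _ /=; rewrite B0 mulr0 addr0.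
    + by apply: filterS filterT => l _ /=; rewrite B0 mulr0 addr0 (negPf A0).
  have {B0}B1 : B < 0 by rewrite ltNge.
  apply: call; apply: filterS => l /= ll; rewrite AlB ?lt_eqF // nmulr_lle0 // subr_ge0 leNgt.
    by rewrite ll.
  by rewrite ltNge ltW.
- rewrite -ltNge => B1.
  apply: call; apply: filterS => l /= ll; rewrite AlB ?gt_eqF // pmulr_lle0 // subr_le0 leNgt.
    by rewrite ltNge ltW.
  by rewrite ll.
- by rewrite /=; lia.
Qed.

Definition search_cost : nat := ((query_cost + 80) * T_J)%N.

(** For [Fl]-many [l] the simulation ends in the final store of the oracle's own run on [par l], so
    the oracle specification holds for the simulated answer. That run also bounds the number of
    simulated steps by [T_J]. *)
Lemma sim_oracle s : rmem s arrA = fA ->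
  (forall j : 'I_n, rmem s (sim_cst 0) j = - cvec j 0) ->
  (forall j : 'I_n, rmem s (sim_lin 0) j = av j 0) ->
  halts inpQ (sim dep (resolve P) P) s search_cost (fun s' =>
    rmem s' arrA = fA /\ Fl [set l |
      if imem s' (sim_int 0) 0 == 0%N then forall x, x \in S -> 0 <= dotp (par l) x
      else exists x, [/\ x \in S, dotp (par l) x < 0 & holds_vec (instance dep s' l) 1 x]]%classic).
Proof.
move=> As sC sL.
have hd l : holds_vec (instance dep s l) 0 (par l).
  by move=> j; rewrite /= dep0 sC sL !mxE addrC.
have [|s' [t' [t [r tt A' H]]]] := sim_ok (compatible_packing_input J eps) resolve_ok P_comb As (B := T_J).
  apply: filterS filterT => l _ /=.
  by have [s' [t [r tT _]]] := P_oracle FJ (hd l); exists s', t.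
have tT : (t <= T_J)%N.
  have /filter_ex[l r1] := H.
  by have [s1 [t1 [r2 tT _]]] := P_oracle FJ (hd l); have [_ ->] := run_det r1 r2.
exists s', t'; split=> //.
  by rewrite /search_cost; apply: leq_trans tt _; apply: leq_mul => //; lia.
split=> //; apply: filterS H => l /= r1.
have [s1 [t1 [r2 _ E]]] := P_oracle FJ (hd l).
by have [s1E _] := run_det r1 r2; rewrite -s1E in E.
Qed.

End Resolve.

(** Just below the largest ratio [lam] the maximiser is violated, so the simulated oracle must
    return some vector. This vector does not vary with [l] and is violated for all [l] close to
    [lam], which forces its ratio to be [lam]. *)
Theorem parametric_search s : rmem s arrA = fA ->
  (forall j : 'I_n, rmem s (sim_cst 0) j = - cvec j 0) ->
  (forall j : 'I_n, rmem s (sim_lin 0) j = av j 0) ->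
  halts inpQ (sim dep (resolve P) P) s search_cost (fun s' =>
    rmem s' arrA = fA /\
    if imem s' (sim_int 0) 0 == 0%N then S = [::]
    else exists x, [/\ x \in S, holds_vec s' (sim_cst 1) x &
      forall z, z \in S -> dotp cvec z <= dotp cvec x / dotp av x * dotp av z]).
Proof.
move=> As sC sL.
have av0 x : x \in S -> 0 < dotp av x.
  by move=> /(gens_nonneg FJ)[x0 xp]; exact: dotp_gt0.
have [S0|Sn0] := eqVneq S [::].
  have h1 l0 : (forall x, x \in S -> 0 <= dotp (par l0) x) -> minfty_germ [set l | l < l0]%classic.
    by exists l0.
  have h2 l0 x : x \in S -> dotp (par l0) x < 0 -> minfty_germ [set l | l0 < l]%classic.
    by rewrite S0.
  have PF := minfty_germ_proper R.
  apply: halts_le (sim_oracle h1 h2 As sC sL) _ _ => // s' [-> H]; split=> //.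
  by move: H; case: ifP => // _ /filter_ex[l [x []]]; rewrite S0.
(* The critical value is known to the proof only; the program never computes it before the search
   ends. *)
have [x0 x0S x0max] := exists_argmax (fun x => dotp cvec x / dotp av x) Sn0.
pose lam := dotp cvec x0 / dotp av x0.
have Slam z : z \in S -> dotp cvec z <= lam * dotp av z.
  by move=> zS; rewrite -ler_pdivrMr ?av0 //; exact: x0max.
have x0lam : dotp cvec x0 = lam * dotp av x0 by rewrite /lam divfK ?gt_eqF ?av0.
have h1 l0 : (forall x, x \in S -> 0 <= dotp (par l0) x) -> left_germ lam [set l | l < l0]%classic.
  move=> /(_ _ x0S); rewrite dotp_par x0lam -mulrBl pmulr_lge0 ?av0 // subr_ge0 => ll0.
  by exists (lam - 1) => [|l /andP[_ llam] /=]; [lra|exact: lt_le_trans ll0].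
have h2 l0 x : x \in S -> dotp (par l0) x < 0 -> left_germ lam [set l | l0 < l]%classic.
  move=> xS; rewrite dotp_par subr_lt0 => /lt_le_trans /(_ (Slam _ xS)).
  rewrite ltr_pM2r ?av0 // => l0lam.
  by exists l0 => // l /andP[].
have PF := left_germ_proper lam.
apply: halts_le (sim_oracle h1 h2 As sC sL) _ _ => // s' [-> H]; split=> //.
move: H; case: ifP => fl H.
  (* The answer that nothing is violated cannot occur, since [x0] is violated at every parameter
     below [lam]. *)
  have lt_lam : left_germ lam [set l | l < lam]%classic by exists (lam - 1) => [|l /andP[]//]; lra.
  have HI := @filterI _ _ (@filter_filter _ _ PF) _ _ H lt_lam.
  have [l [/(_ _ x0S) + llam]] := filter_ex HI.
  by rewrite dotp_par x0lam -mulrBl pmulr_lge0 ?av0 // subr_ge0 leNgt llam.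
have [a alam Ha] := H.
pose v j := if dep 1%N then rmem s' (sim_lin 1) j else 0.
have inst l (j : nat) : rmem (instance dep s' l) 1 j = rmem s' (sim_cst 1) j + l * v j.
  by rewrite /instance /= /v; case: ifP => // _; rewrite mulr0 addr0.
(* Each coordinate of the answer is affine in [l] and takes values among the finitely many
   coordinates of elements of [S], so its slope vanishes and the constant part alone is the
   vector. *)
have v0 (j : 'I_n) : v j = 0.
  apply: (@affine_finite_range _ (rmem s' (sim_cst 1) j) _ _ _ [seq x j 0 | x : 'cV[R]_n <- S] alam) => l /Ha[x [xS _ hx]].
  by rewrite -inst hx; apply/mapP; exists x.
have [x [xS _ hx]] := Ha ((a + lam) / 2) ltac:(rewrite !midf_lt //).
have hv : holds_vec s' (sim_cst 1) x.
  by move=> j; rewrite -hx inst v0 mulr0 addr0.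
exists x; split=> // z zS; apply: le_trans (Slam z zS) _.
rewrite ler_pM2r ?av0 // leNgt; apply/negP => xlam.
(* If the ratio of [x] were below [lam], a parameter between the two, close enough to [lam], would
   not violate [x]. *)
pose m := Num.max a (dotp cvec x / dotp av x).
have mlam : m < lam by rewrite gt_max alam.
have am : a <= m by rewrite le_max lexx.
have rm : dotp cvec x / dotp av x <= m by rewrite le_max lexx orbT.
have [|y [yS + hy]] := Ha ((m + lam) / 2).
  by rewrite !midf_lt // andbT (le_lt_trans am) // midf_lt.
have -> : y = x.
  by apply/matrixP => j k; rewrite !ord1 -hy -hx !inst v0 !mulr0.
rewrite dotp_par subr_lt0 -ltr_pdivlMr ?av0 // ltNge; apply/negP/negPn.
by apply: le_trans rm _; rewrite ltW // midf_lt.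
Qed.

End ParametricSearch.

                                                       

(** * The generated cone and linear functionals on it *)

Section Cones.
Variables (R : realType) (n : nat) (S : seq 'cV[R]_n).

Lemma in_cone0 : in_cone S 0.
Proof.
by exists (fun=> 0) => // ; rewrite big1 // => l _; rewrite scale0r.
Qed.

Lemma in_coneZ k x : 0 <= k -> in_cone S x -> in_cone S (k *: x).
Proof.
move=> k0 [al al0 ->]; exists (fun l => k * al l) => [l|]; first exact: mulr_ge0.
by rewrite scaler_sumr; apply: eq_bigr => l _; rewrite scalerA.
Qed.

Lemma in_coneD x y : in_cone S x -> in_cone S y -> in_cone S (x + y).
Proof.
move=> [al al0 ->] [be be0 ->]; exists (fun l => al l + be l) => [l|].
  exact: addr_ge0.
by rewrite -big_split; apply: eq_bigr => l _; rewrite scalerDl.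
Qed.

Lemma in_cone_gen x : x \in S -> in_cone S x.
Proof.
move=> xS; have ix : (index x S < size S)%N by rewrite index_mem.
exists (fun l => (l == Ordinal ix)%:R) => [l|]; first exact: ler0n.
rewrite (bigD1 (Ordinal ix)) //= eqxx scale1r nth_index // big1 ?addr0 //.
by move=> l /negPf->; rewrite scale0r.
Qed.

Lemma dotpDr (u x y : 'cV[R]_n) : dotp u (x + y) = dotp u x + dotp u y.
Proof. by rewrite /dotp -big_split; apply: eq_bigr => j _; rewrite !mxE mulrDr. Qed.

Lemma dotpZr k (u x : 'cV[R]_n) : dotp u (k *: x) = k * dotp u x.
Proof. by rewrite /dotp mulr_sumr; apply: eq_bigr => j _; rewrite !mxE mulrCA. Qed.

Lemma dotp_cone_ge0 (u x : 'cV[R]_n) :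
  (forall z, z \in S -> 0 <= dotp u z) -> in_cone S x -> 0 <= dotp u x.
Proof.
move=> uS [al al0 ->].
have -> : dotp u (\sum_l al l *: S`_l) = \sum_l al l * dotp u S`_l.
  apply: (big_ind2 (fun x y => dotp u x = y)) => [|x1 y1 x2 y2 <- <-|l _].
  - by rewrite /dotp big1 // => j _; rewrite mxE mulr0.
  - exact: dotpDr.
  - exact: dotpZr.
by apply: sumr_ge0 => l _; rewrite mulr_ge0 // uS // mem_nth.
Qed.

End Cones.

(** * The multiplicative weights method and its potential function *)

Section Weights.
Variables (R : realType) (J : packing R).
Notation m := (nrows J).
Notation n := (cone_dim (pcone J)).
Notation S := (gens (pcone J)).
Notation cv := (cvec J).
Hypothesis Jok : packing_ok J.
Hypothesis Sok : gens_ok (pcone J).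

Definition Amat : 'M[R]_(m, n) := map_mx (GRing.natmul 1) (matA J).
Definition bval (i : 'I_m) : R := (vecb J i 0)%:R.
Definition aty (y : 'I_m -> R) : 'cV[R]_n := \col_j \sum_i Amat i j * y i.

Definition unit_weights (i : 'I_m) : R := (bval i)^-1.

Lemma bval_gt0 i : 0 < bval i.
Proof. by case: Jok => _ _ b0; rewrite ltr0n. Qed.

Lemma Amat_ge0 i j : 0 <= Amat i j.
Proof. by rewrite mxE ler0n. Qed.

Lemma Amatx_ge0 x i : x \in S -> 0 <= (Amat *m x) i 0.
Proof.
by move=> /Sok[_ x0]; rewrite mxE sumr_ge0 // => j _; rewrite mulr_ge0 // Amat_ge0.
Qed.

Lemma aty_gt0 y : (forall i, 0 < y i) -> forall j, 0 < aty y j 0.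
Proof.
move=> y0 j; case: Jok => _ /(_ j)[i Aij] _; rewrite mxE (bigD1 i) //=.
rewrite ltr_wpDr ?sumr_ge0 //; last by rewrite mulr_gt0 // mxE ltr0n.
by move=> k _; rewrite mulr_ge0 ?Amat_ge0 // ltW.
Qed.

Lemma dotp_aty y x : dotp (aty y) x = \sum_i y i * (Amat *m x) i 0.
Proof.
rewrite /dotp.
under eq_bigr => j _ do rewrite mxE mulr_suml.
rewrite exchange_big; apply: eq_bigr => i _; rewrite [in RHS]mxE mulr_sumr.
by apply: eq_bigr => j _; rewrite mulrA [_ * y i]mulrC.
Qed.

Lemma dotp_aty_gt0 y x : (forall i, 0 < y i) -> x \in S -> 0 < dotp (aty y) x.
Proof. by move=> y0 /Sok[? ?]; apply: dotp_gt0 => //; exact: aty_gt0. Qed.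

(** Taking reciprocals turns this into [1 + u <= expR u] at [u = - t / (1 + t)]. *)
Lemma expR_le_1D (t : R) : 0 <= t -> expR (t / (1 + t)) <= 1 + t.
Proof.
move=> t0; have t1 : 0 < 1 + t by lra.
rewrite -[leRHS]invrK -[leLHS]invrK -expRN lef_pV2 ?posrE ?expR_gt0 ?invr_gt0 //.
apply: le_trans (expR_ge1Dx _).
by rewrite le_eqVlt; apply/orP; left; apply/eqP; field; lra.
Qed.

Lemma feasible0 : @feasible R J 0.
Proof. by split=> [i|]; [rewrite mulmx0 mxE ler0n|exact: in_cone0]. Qed.

(** Reduces statements about the supremum to single feasible points; the zero vector makes the set
    of values nonempty. *)
Lemma optimum_le (k v : R) : 0 < k -> (forall z, @feasible R J z -> k * objective z <= v) ->
  k * optimum J <= v.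
Proof.
move=> k0 H; rewrite mulrC -ler_pdivlMr //; apply: ge_sup.
  by exists (objective (0 : 'cV[R]_n)), 0 => //; exact: feasible0.
by move=> _ [z zf ->]; rewrite ler_pdivlMr // mulrC; exact: H.
Qed.

Variables (e mu0 : R) (e_gt0 : 0 < e) (e_lt1 : e < 1) (mu0_gt0 : 0 < mu0).

(** The state after [v] augmentations and [r] reductions of [mu]: [X] is the unscaled solution and
    [L] its relative loads. The fields [mw_lower] and [mw_total] bound the potential from below and
    above for the approximation guarantee; [mw_upper], [mw_mu] and [mw_count] serve to bound the
    number of iterations. *)
Record mw_inv (v r : nat) (y L : 'I_m -> R) (X : 'cV[R]_n) (mu : R) : Prop := MwInv {
  mw_cone : in_cone S X;
  mw_obj : 0 <= objective X;
  mw_load : forall i, (Amat *m X) i 0 = L i * bval i;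
  mw_load_ge0 : forall i, 0 <= L i;
  mw_lower : forall i, expR (e * L i / (1 + e)) <= y i * bval i;
  mw_upper : forall i, y i * bval i <= expR (e * L i);
  mw_ratio : forall x, x \in S -> dotp cv x <= mu * dotp (aty y) x;
  mw_total : forall z, @feasible R J z -> 0 < objective z ->
    \sum_i y i * bval i <= m%:R * expR (e * (1 + e) * (objective X / objective z));
  mw_mu : mu = mu0 / (1 + e) ^+ r;
  mw_count : v%:R <= \sum_i L i }.

Lemma mw_init : (forall x, x \in S -> dotp cv x <= mu0 * dotp (aty unit_weights) x) ->
  mw_inv 0 0 unit_weights (fun=> 0) 0 mu0.
Proof.
move=> H.
have obj0 : objective (0 : 'cV[R]_n) = 0.
  by rewrite /objective /dotp big1 // => j _; rewrite [X in _ * X]mxE mulr0.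
split=> //.
- exact: in_cone0.
- by rewrite obj0.
- by move=> i; rewrite mulmx0 mxE mul0r.
- by move=> i; rewrite mulr0 mul0r expR0 mulVf // gt_eqF // bval_gt0.
- by move=> i; rewrite mulr0 expR0 mulVf // gt_eqF // bval_gt0.
- move=> z _ _; rewrite obj0 mul0r mulr0 expR0 mulr1.
  rewrite (eq_bigr (fun=> 1)); last by move=> i _; rewrite mulVf // gt_eqF // bval_gt0.
  by rewrite sumr_const card_ord.
- by rewrite expr0 divr1.
- by rewrite sumr_ge0.
Qed.

Lemma mw_y_gt0 v r y L X mu i : mw_inv v r y L X mu -> 0 < y i.
Proof.
move=> I; have := mw_lower I i; move/(lt_le_trans (expR_gt0 _)).
by rewrite pmulr_lgt0 // bval_gt0.
Qed.

Lemma mw_mu_gt0 v r y L X mu : mw_inv v r y L X mu -> 0 < mu.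
Proof. by move=> I; rewrite (mw_mu I) divr_gt0 // exprn_gt0 // addr_gt0. Qed.

Lemma mw_lower_mu v r y L X mu : mw_inv v r y L X mu ->
  (forall x, x \in S -> 0 <= dotp (mu / (1 + e) *: aty y - cv) x) ->
  mw_inv v r.+1 y L X (mu / (1 + e)).
Proof.
move=> I H; case: (I) => *; split=> //.
  by move=> x xS; have := H _ xS; rewrite dotpBl dotpZl subr_ge0.
by rewrite (mw_mu I) exprSr invfM mulrA.
Qed.

                                                                               
(** Weak duality: by [mw_ratio] the vector [mu y] is dual feasible on the generators, hence on the
    whole cone. *)
Lemma objective_le_weights v r y L X mu z : mw_inv v r y L X mu -> @feasible R J z ->
  objective z <= mu * \sum_i y i * bval i.
Proof.
move=> I [zf zc].
have : 0 <= dotp (mu *: aty y - cv) z.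
  apply: dotp_cone_ge0 zc => x xS; rewrite dotpBl dotpZl subr_ge0.
  exact: mw_ratio I _ xS.
rewrite dotpBl dotpZl subr_ge0 => /le_trans; apply.
rewrite ler_pM2l ?(mw_mu_gt0 I) // dotp_aty ler_sum // => i _.
by rewrite ler_pM2l ?(mw_y_gt0 _ I).
Qed.

(** Dividing by the largest load [sg] gives [0 <= w i <= 1], so [1 + e w] lies between
    [expR (e w / (1 + e))] and [expR (e w)], which preserves both exponential bounds. Weights only
    grow and [A x] is nonnegative, so [mu] remains a bound on the ratios. *)
Lemma mw_step v r y L X mu x sg w :
  mw_inv v r y L X mu -> x \in S ->
  dotp (mu / (1 + e) *: aty y - cv) x < 0 ->
  0 < sg -> (forall i, (Amat *m x) i 0 / bval i <= sg) ->
  (exists i, sg = (Amat *m x) i 0 / bval i) ->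
  (forall i, w i = (Amat *m x) i 0 / bval i / sg) ->
  mw_inv v.+1 r (fun i => y i * (1 + e * w i)) (fun i => L i + w i)
    (X + sg^-1 *: x) mu.
Proof.
move=> I xS xviol sg0 sgmax [i0 i0max] wE.
have y_gt0 i := mw_y_gt0 i I; have mu_gt0 := mw_mu_gt0 I.
have b_gt0 := bval_gt0.
have w_ge0 i : 0 <= w i by rewrite wE !divr_ge0 ?Amatx_ge0 // ltW.
have w_le1 i : w i <= 1 by rewrite wE ler_pdivrMr // mul1r.
have axy : 0 < dotp (aty y) x by exact: dotp_aty_gt0.
have viol : mu / (1 + e) * dotp (aty y) x < dotp cv x.
  by move: xviol; rewrite dotpBl dotpZl subr_lt0.
have e1 : 0 < 1 + e by rewrite addr_gt0.
have ep := e_gt0; have el := e_lt1.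
have cx : 0 < dotp cv x.
  by apply: lt_trans viol; rewrite mulr_gt0 // divr_gt0.
have objE : objective (X + sg^-1 *: x) = objective X + dotp cv x / sg.
  by rewrite /objective dotpDr dotpZr [_^-1 * _]mulrC.
split.
- apply: in_coneD; first exact: mw_cone I.
  by apply: in_coneZ (in_cone_gen xS); rewrite invr_ge0 ltW.
- by rewrite objE addr_ge0 ?(mw_obj I) // divr_ge0 // ltW.
- move=> i; rewrite mulmxDr -scalemxAr [LHS]mxE [X in _ + X]mxE (mw_load I) mulrDl wE; congr (_ + _).
  by field; rewrite -/(bval i) !gt_eqF.
- by move=> i; rewrite addr_ge0 // (mw_load_ge0 I).
- move=> i.
  have -> : e * (L i + w i) / (1 + e) = e * L i / (1 + e) + e * w i / (1 + e).
    by rewrite mulrDr mulrDl.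
  rewrite expRD [leRHS]mulrAC; apply: ler_pM; [exact: expR_ge0|exact: expR_ge0|exact: mw_lower I i|].
  have ew0 : 0 <= e * w i by apply: mulr_ge0 => //; exact: ltW.
  apply: le_trans (expR_le_1D ew0); rewrite ler_expR; apply: ler_wpM2l => //.
  rewrite lef_pV2 ?posrE ?e1 ?ltr_wpDr // lerD2l ler_piMr // ltW //.
- move=> i; have ew0 : 0 <= e * w i by apply: mulr_ge0 => //; exact: ltW.
  rewrite [e * (_ + _)]mulrDr expRD [leLHS]mulrAC; apply: ler_pM.
  + by apply: mulr_ge0; exact: ltW.
  + exact: addr_ge0.
  + exact: mw_upper I i.
  + exact: expR_ge1Dx.
- move=> z zS; apply: le_trans (mw_ratio I zS) _.
  rewrite ler_pM2l // !dotp_aty ler_sum // => i _.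
  by rewrite ler_wpM2r ?Amatx_ge0 // ler_peMr ?(ltW (y_gt0 i)) // lerDl mulr_ge0 // ltW.
- move=> z zf z0.
  set D := \sum_i y i * bval i.
  have D0 : 0 < D.
    have := lt_le_trans z0 (objective_le_weights I zf).
    by rewrite pmulr_rgt0.
  have -> : \sum_i y i * (1 + e * w i) * bval i = D + e / sg * dotp (aty y) x.
    rewrite dotp_aty mulr_sumr -big_split; apply: eq_bigr => i _ /=.
    by rewrite wE; field; rewrite -/(bval i) !gt_eqF.
  (* The potential grows by [e / sg] times [(A^T y)^T x]. The violation bounds this product by
     [(1 + e) / mu] times [c^T x], and weak duality bounds [1 / mu] by [D / c^T z]; so [D] grows at
     most by the factor shown. *)
  apply: (@le_trans _ _ (D * (1 + e * (1 + e) * (dotp cv x / sg / objective z)))).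
    rewrite mulrDr mulr1 lerD2l.
    have h1 : dotp (aty y) x <= (1 + e) / mu * dotp cv x.
      rewrite mulrAC ler_pdivlMr // mulrC; move/ltW: viol.
      by rewrite mulrAC ler_pdivrMr // [_ * (1 + e)]mulrC.
    have h2 : mu^-1 <= D / objective z.
      rewrite ler_pdivlMr // mulrC ler_pdivrMr // mulrC.
      exact: objective_le_weights I zf.
    have -> : D * (e * (1 + e) * (dotp cv x / sg / objective z)) =
      e / sg * ((1 + e) * (D / objective z) * dotp cv x).
      by field; rewrite !gt_eqF.
    rewrite ler_pM2l ?divr_gt0 //; apply: le_trans h1 _.
    by rewrite ler_pM2r // ler_pM2l.
  rewrite objE [X in expR (_ * X)]mulrDl [X in expR X]mulrDr expRD [leRHS]mulrA.
  apply: ler_pM.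
  + exact: ltW.
  + apply: addr_ge0 => //; apply: mulr_ge0; first by apply: mulr_ge0; exact: ltW.
    by apply: divr_ge0; [apply: divr_ge0|]; exact: ltW.
  + exact: mw_total I _ zf z0.
  + exact: expR_ge1Dx.
- exact: mw_mu I.
(* The row [i0] attaining the largest load has [w i0 = 1], so each augmentation raises the total
   load by at least 1. *)
- rewrite -natr1 big_split lerD ?(mw_count I) // (bigD1 i0) //= wE -i0max divff ?gt_eqF //.
  by rewrite lerDl sumr_ge0.
Qed.

(** Augmentations are counted by the total load, at most [m thr]. For reductions, follow the initial
    maximiser [xs]: its weighted cost has grown at most by [expR (e thr)], while [mu] has dropped by
    [(1 + e) ^ r] and still bounds its ratio. Hence [(1 + e) ^ r <= expR (e thr)], which gives
    [r <= (1 + e) thr <= 2 thr]. *)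
Lemma mw_iterations v r y L X mu thr xs : mw_inv v r y L X mu -> 0 <= thr ->
  (forall i, L i <= thr) -> xs \in S -> dotp cv xs = mu0 * dotp (aty unit_weights) xs ->
  (v + r)%:R <= (m%:R + 2) * thr.
Proof.
move=> I thr0 Lthr xsS xsE.
have e1 : 0 < 1 + e by rewrite addr_gt0.
have ep := e_gt0; have el := e_lt1.
rewrite natrD mulrDl lerD //.
  apply: le_trans (mw_count I) _; apply: le_trans (ler_sum _ (fun i _ => Lthr i)) _.
  by rewrite sumr_const card_ord mulr_natl.
have ay0 : 0 < dotp (aty unit_weights) xs.
  by apply: dotp_aty_gt0 => // i; rewrite invr_gt0 bval_gt0.
have h1 : dotp (aty y) xs <= expR (e * thr) * dotp (aty unit_weights) xs.
  rewrite !dotp_aty mulr_sumr ler_sum // => i _; rewrite mulrA ler_wpM2r ?Amatx_ge0 //.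
  rewrite ler_pdivlMr ?bval_gt0 //; apply: le_trans (mw_upper I i) _.
  by rewrite ler_expR ler_pM2l.
have h2 : (1 + e) ^+ r <= expR (e * thr).
  have p0 : 0 < (1 + e) ^+ r by rewrite exprn_gt0.
  have := mw_ratio I xsS; rewrite xsE (mw_mu I) => H.
  have {}H : mu0 * dotp (aty unit_weights) xs <= mu0 / (1 + e) ^+ r * (expR (e * thr) * dotp (aty unit_weights) xs).
    by apply: le_trans H _; rewrite ler_pM2l // divr_gt0.
  move: H; rewrite mulrA ler_pM2r // mulrAC ler_pdivlMr // ler_pM2l //.
have h3 : expR (e / (1 + e) * r%:R) <= (1 + e) ^+ r.
  rewrite expRM_natr; apply: lerXn2r; rewrite ?nnegrE ?expR_ge0 ?(ltW e1) //.
  by apply: expR_le_1D; exact: ltW.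
have := le_trans h3 h2; rewrite ler_expR mulrAC ler_pdivrMr // -mulrA ler_pM2l // => h4.
by apply: le_trans h4 _; rewrite mulrC ler_wpM2r //; lra.
Qed.

(** With [g = c^T X / c^T z], the two bounds on the potential give
    [e M / (1 + e) <= k + e (1 + e) g], where [m <= 2 ^ k <= expR k] is used. The size of [M]
    absorbs [k] into [e^2 M], leaving [(1 - 2 e) M <= (1 + e) g], and so [(1 - 3 e) M <= g]. *)
Lemma mw_final v r y L X mu M (k : nat) : mw_inv v r y L X mu ->
  (forall i, L i <= M) -> (exists i, M <= L i) -> k%:R / (e * e) < M ->
  (m <= 2 ^ k)%N -> 3 * e < 1 ->
  @feasible R J (M^-1 *: X) /\
  forall z, @feasible R J z -> (1 - 3 * e) * objective z <= objective (M^-1 *: X).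
Proof.
move=> I LM [i0 i0M] kM mk e3.
have M0 : 0 < M by apply: le_lt_trans kM; rewrite divr_ge0 // mulr_ge0 // ltW.
have e1 : 0 < 1 + e by rewrite addr_gt0.
have ep := e_gt0; have el := e_lt1.
have MV : 0 <= M^-1 by rewrite invr_ge0 ltW.
split.
  split; last exact: in_coneZ (mw_cone I).
  move=> i; rewrite -scalemxAr [leLHS]mxE -/Amat (mw_load I) mulrC ler_pdivrMr // mulrC.
  by rewrite ler_pM2l ?bval_gt0.
move=> z zf; rewrite /objective dotpZr -/(objective X) -/(objective z).
have [z0|z0] := leP (objective z) 0.
  apply: (@le_trans _ _ 0); last by rewrite mulr_ge0 // (mw_obj I).
  by rewrite mulr_ge0_le0 //; lra.
set g := objective X / objective z.
suff H : (1 - 3 * e) * M <= g.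
  by rewrite [leRHS]mulrC ler_pdivlMr // mulrAC -ler_pdivlMr.
have h1 : expR (e * M / (1 + e)) <= 2 ^+ k * expR (e * (1 + e) * g).
  apply: (@le_trans _ _ (\sum_i y i * bval i)).
    rewrite (bigD1 i0) //= ler_wpDr //.
      by apply: sumr_ge0 => i _; rewrite mulr_ge0 ?(ltW (mw_y_gt0 _ I)) // ltW // bval_gt0.
    apply: le_trans (mw_lower I i0); rewrite ler_expR ler_pM2r ?invr_gt0 //.
    by rewrite ler_pM2l.
  apply: le_trans (mw_total I zf z0) _.
  by rewrite ler_wpM2r ?expR_ge0 // -natrX ler_nat.
have h2 : 2 ^+ k <= expR k%:R :> R.
  rewrite -[k%:R]mul1r expRM_natr lerXn2r ?nnegrE ?expR_ge0 //.
  exact: expR_ge1Dx.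
have h3 : e * M / (1 + e) <= k%:R + e * (1 + e) * g.
  rewrite -ler_expR expRD; apply: le_trans h1 _.
  by rewrite ler_wpM2r ?expR_ge0.
have h4 : k%:R <= e * (e * M).
  by move: kM; rewrite ltr_pdivrMr ?mulr_gt0 // mulrC mulrA => /ltW.
have h5 : M / (1 + e) <= e * M + (1 + e) * g.
  rewrite -(ler_pM2l e_gt0) mulrDr [leLHS]mulrA [e * ((1 + e) * g)]mulrA.
  by apply: le_trans h3 _; rewrite lerD2r.
have h6 : (1 - e) * M <= M / (1 + e).
  rewrite ler_pdivlMr // mulrAC; rewrite -[leRHS]mul1r ler_pM2r //; nra.
have h7 : (1 - 2 * e) * M <= (1 + e) * g by lra.
rewrite -(ler_pM2l e1); apply: le_trans h7; rewrite mulrA ler_pM2r //; nra.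
Qed.

End Weights.

                                    

(** * The approximation scheme as a program, and its correctness *)

Definition arrY : nat := 4.
Definition arrL : nat := 8.
Definition arrX : nat := 12.
Definition arrW : nat := 16.
Definition muA : nat := 32.
Definition maxA : nat := 36.
Definition thrA : nat := 40.
Definition epsA : nat := 44.
Definition sgA : nat := 48.
Definition cxA : nat := 52.
Definition axA : nat := 56.
Definition powA : nat := 6.
(** The prescribed output array coincides with the query array [orc_real 0]; sharing is safe because
    no oracle call follows the output loop. *)
Definition arrOut : nat := 1.

Notation mE := (IFile 2 iz).
Notation NE := (IFile 2 (IConst 1)).
Notation rowE := (IFile 3 lv).
Notation colE := (IFile 4 lv).
Notation valE := (RFile 1 lv).
Notation bE := (RFile 2 lv).
Notation epsE := (RFile 4 iz).
Notation cell a := (RLoad a iz).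
Notation entry a := (RLoad a lv).

Definition mul_trans : cmd :=
  Seq (For nE (RSet arrA lv (RConst 0)))
      (For NE (RSet arrA colE (RAdd (RLoad arrA colE) (RMul valE (RLoad arrY rowE))))).

Definition setup : cmd :=
  Seq (RSet epsA iz (RDiv epsE (RConst 3)))
 (Seq (For mE (RSet arrY lv (RDiv (RConst 1) bE)))
 (Seq (For mE (RSet arrL lv (RConst 0)))
 (Seq (For nE (RSet arrX lv (RConst 0)))
 (Seq mul_trans
 (Seq (For nE (RSet (sim_cst 0) lv (RSub (RConst 0) cE)))
      (For nE (RSet (sim_lin 0) lv (entry arrA)))))))).

Definition augment : cmd :=
  Seq (For mE (RSet arrW lv (RConst 0)))
 (Seq (For NE (RSet arrW rowE (RAdd (RLoad arrW rowE) (RMul valE (RLoad (orc_real 1) colE)))))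
 (Seq (RSet sgA iz (RConst 0))
 (Seq (For mE (If (RLe (cell sgA) (RDiv (entry arrW) bE))
                  (RSet sgA iz (RDiv (entry arrW) bE)) Skip))
 (Seq (For nE (RSet arrX lv (RAdd (entry arrX) (RDiv (entry (orc_real 1)) (cell sgA)))))
 (Seq (For mE (RSet arrW lv (RDiv (RDiv (entry arrW) bE) (cell sgA))))
 (Seq (For mE (RSet arrY lv (RMul (entry arrY)
                 (RAdd (RConst 1) (RMul (cell epsA) (entry arrW))))))
 (Seq (For mE (RSet arrL lv (RAdd (entry arrL) (entry arrW))))
      (For mE (If (RLe (cell maxA) (entry arrL)) (RSet maxA iz (entry arrL)) Skip))))))))).

Definition iteration (P : cmd) : cmd :=
  Seq mul_trans
 (Seq (RSet lamA iz (RDiv (cell muA) (RAdd (RConst 1) (cell epsA))))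
 (Seq (query P)
      (If query_ok_test (RSet muA iz (cell lamA)) augment))).

                                                                       
(** Indices can be added but not multiplied, so the binary logarithm of the number of rows is found
    by doubling [powA], the doublings being counted in a real cell. *)
Definition threshold : cmd :=
  Seq (ISet powA iz (IConst 1))
 (Seq (RSet thrA iz (RConst 0))
 (Seq (While (ILe (IAdd (ILoad powA iz) (IConst 1)) mE)
        (Seq (ISet powA iz (IAdd (ILoad powA iz) (ILoad powA iz)))
             (RSet thrA iz (RAdd (cell thrA) (RConst 1)))))
      (RSet thrA iz (RDiv (cell thrA) (RMul (cell epsA) (cell epsA)))))).

Definition output_zero : cmd := For nE (RSet arrOut lv (RConst 0)).

Definition weights_loop (P : cmd) : cmd :=
  Seq (RSet muA iz (RDiv (cell cxA) (cell axA)))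
 (Seq threshold
 (Seq (RSet maxA iz (RConst 0))
 (Seq (While (RLe (cell maxA) (cell thrA)) (iteration P))
      (For nE (RSet arrOut lv (RDiv (entry arrX) (cell maxA))))))).

Definition fptas (dep : pred nat) (P : cmd) : cmd :=
  Seq setup
 (Seq (sim dep (resolve P) P)
      (If (ILe (ILoad (sim_int 0) iz) iz) output_zero
        (Seq (RSet cxA iz (RConst 0))
        (Seq (For nE (RSet cxA iz (RAdd (cell cxA) (RMul cE (entry (sim_cst 1))))))
        (Seq (RSet axA iz (RConst 0))
        (Seq (For nE (RSet axA iz (RAdd (cell axA) (RMul (entry arrA) (entry (sim_cst 1))))))
             (If (RLe (cell cxA) (RConst 0)) output_zero (weights_loop P)))))))).

Lemma updE (T : Type) (f : nat -> nat -> T) a i v : upd f a i v a i = v.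
Proof. by rewrite /upd !eqxx. Qed.

Lemma halts_rset_cell (R : realType) (inp : input R) A e s :
  halts inp (RSet A iz e) s (rcost e + 2) (fun s' =>
    [/\ imem s' = imem s, forall a, a <> A -> rmem s' a = rmem s a &
        rmem s' A 0 = reval inp s e]).
Proof.
apply: halts_le (halts_rset (Q := _) _) _ (fun _ => id); last by rewrite /=; lia.
split=> //=; last exact: updE.
by move=> a aA; apply/funext => i; rewrite /upd; case: eqP.
Qed.

Definition loop_factor : nat := 2500.

Section Program.
Variables (R : realType) (F : cone_inst R -> Prop) (P : cmd) (T : cone_inst R -> nat).
Hypothesis gens_nonneg : forall I, F I -> gens_ok I.
Hypothesis P_oracle : separation_oracle F P T.
Variables (J : packing R) (eps : R).
Hypothesis FJ : F (pcone J).
Hypothesis Jok : packing_ok J.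
Hypothesis eps01 : 0 < eps < 1.

Notation inpQ := (packing_input J eps).
Notation n := (cone_dim (pcone J)).
Notation m := (nrows J).
Notation N := (nnz J).
Notation S := (gens (pcone J)).
Notation T_J := (T (pcone J)).
Notation cv := (cvec J).
Notation b := (bval (J := J)).

Let Sok : gens_ok (pcone J) := gens_nonneg FJ.

Lemma eval_mE s : ieval inpQ s mE = m. Proof. by []. Qed.
Lemma eval_NE s : ieval inpQ s NE = N. Proof. by []. Qed.

Lemma nth_bval (i : 'I_m) : nth 0 (rfile inpQ 2) i = b i.
Proof. by rewrite /= nth_map_enum_ord. Qed.

Let E := enum (nonzeros J).

Lemma sum_nnz (p : pred nat) (g : nat -> R) (Q : pred ('I_m * 'I_n)) G :
  (forall x k, (k < size E)%N -> p k = Q (nth x E k) /\ g k = G (nth x E k)) ->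
  \sum_(k < N | p k) g k = \sum_(ij in nonzeros J | Q ij) G ij.
Proof.
move=> H; rewrite -big_enum_cond -/E.
have -> : N = size E by rewrite /nnz cardE.
case: E H => [|x E'] H; first by rewrite big_nil big_ord0.
rewrite (big_nth x) big_mkord; apply: eq_big => [k|k _].
  by have [] := H x k (ltn_ord k).
by have [] := H x k (ltn_ord k).
Qed.

Lemma sum_nonzeros (Q : pred ('I_m * 'I_n)) (f : 'I_m * 'I_n -> R) :
  \sum_(ij in nonzeros J | Q ij) (matA J ij.1 ij.2)%:R * f ij =
  \sum_(ij | Q ij) Amat J ij.1 ij.2 * f ij.
Proof.
rewrite [RHS](bigID [in nonzeros J]) /= [X in _ + X]big1 ?addr0.
  by apply: eq_big => [ij|ij _]; rewrite ?mxE // andbC.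
by move=> ij /andP[_]; rewrite inE negbK => /eqP A0; rewrite mxE A0 mul0r.
Qed.

(** Entries missing from the list of nonzeros contribute 0, so a pass over the list computes the
    full column sum. *)
Lemma sum_column (f : nat -> R) (j : 'I_n) :
  \sum_(k < N | nth 0%N (ifile inpQ 4) k == j)
     nth 0 (rfile inpQ 1) k * f (nth 0%N (ifile inpQ 3) k) =
  \sum_i Amat J i j * f i.
Proof.
rewrite (@sum_nnz (fun k => nth 0%N (ifile inpQ 4) k == j)
  (fun k => nth 0 (rfile inpQ 1) k * f (nth 0%N (ifile inpQ 3) k))
  (fun ij => ij.2 == j) (fun ij => (matA J ij.1 ij.2)%:R * f ij.1)); last first.
  by move=> x k kE; rewrite /= !(nth_map x).
rewrite (@sum_nonzeros (fun ij => ij.2 == j) (fun ij => f ij.1)).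
rewrite -(pair_big_dep xpredT (fun _ j' => j' == j) (fun i j' => Amat J i j' * f i)) /=.
by apply: eq_bigr => i _; rewrite big_pred1_eq.
Qed.

Lemma sum_row (f : nat -> R) (i : 'I_m) :
  \sum_(k < N | nth 0%N (ifile inpQ 3) k == i)
     nth 0 (rfile inpQ 1) k * f (nth 0%N (ifile inpQ 4) k) =
  \sum_j Amat J i j * f j.
Proof.
rewrite (@sum_nnz (fun k => nth 0%N (ifile inpQ 3) k == i)
  (fun k => nth 0 (rfile inpQ 1) k * f (nth 0%N (ifile inpQ 4) k))
  (fun ij => ij.1 == i) (fun ij => (matA J ij.1 ij.2)%:R * f ij.2)); last first.
  by move=> x k kE; rewrite /= !(nth_map x).
rewrite (@sum_nonzeros (fun ij => ij.1 == i) (fun ij => f ij.2)).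
rewrite (eq_bigl (fun ij : 'I_m * 'I_n => (ij.1 == i) && true)); last by move=> ij; rewrite andbT.
rewrite -(pair_big_dep (fun i' => i' == i) (fun _ _ => true) (fun i' j => Amat J i' j * f j)) /=.
by rewrite big_pred1_eq.
Qed.

Let Z := (n + m + N + 1)%N.

Lemma mul_trans_ok s (y : 'I_m -> R) : (forall i : 'I_m, rmem s arrY i = y i) ->
  halts inpQ mul_trans s (40 * Z + 40) (fun s' =>
    [/\ forall a, a <> arrA -> rmem s' a = rmem s a &
        forall j : 'I_n, rmem s' arrA j = aty y j 0]).
Proof.
move=> sy; apply: halts_cost.
  apply: (halts_seq (halts_for_map (@eval_nE R J eps) _)) => // s1 [_ f1 v1].
  apply: (halts_post (halts_for_sum eval_NE _)); first by split=> //; left.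
  move=> s2 [_ f2 v2]; split=> [a aA|j]; first by rewrite f2 // f1.
  rewrite v2 v1 // add0r mxE.
  under eq_bigl => k do rewrite /= updE.
  under eq_bigr => k _ do rewrite /= updE.
  rewrite (sum_column (rmem s1 arrY)); apply: eq_bigr => i _.
  by rewrite f1 // sy.
by rewrite /for_cost /Z /=; lia.
Qed.

Lemma setup_ok s : halts inpQ setup s (1000 * Z) (fun s' =>
  [/\ rmem s' epsA 0 = eps / 3,
      forall i : 'I_m, rmem s' arrY i = unit_weights i,
      forall i : 'I_m, rmem s' arrL i = 0,
      forall j : 'I_n, rmem s' arrX j = 0 &
      [/\ forall j : 'I_n, rmem s' arrA j = aty (unit_weights (J := J)) j 0,
      forall j : 'I_n, rmem s' (sim_cst 0) j = - cv j 0 &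
      forall j : 'I_n, rmem s' (sim_lin 0) j = aty (unit_weights (J := J)) j 0]]).
Proof.
apply: halts_cost.
  apply: (halts_seq (halts_rset_cell _ _ _ _)) => s1 [_ f1 v1].
  apply: (halts_seq (halts_for_map eval_mE _)) => // s2 [_ f2 v2].
  apply: (halts_seq (halts_for_map eval_mE _)) => // s3 [_ f3 v3].
  apply: (halts_seq (halts_for_map (@eval_nE R J eps) _)) => // s4 [_ f4 v4].
  have y4 (i : 'I_m) : rmem s4 arrY i = unit_weights i.
    rewrite f4 // f3 // v2 // /unit_weights -nth_bval.
    by rewrite [reval _ _ _]/= updE mul1r.
  apply: (halts_seq (mul_trans_ok y4)) => s5 [f5 v5].
  apply: (halts_seq (halts_for_map (@eval_nE R J eps) _)) => // s6 [_ f6 v6].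
  apply: (halts_post (halts_for_map (@eval_nE R J eps) _)) => [|s7 [_ f7 v7]].
    by left.
  split; last split.
  - by rewrite f7 // f6 // f5 // f4 // f3 // f2 // v1.
  - by move=> i; rewrite f7 // f6 // f5.
  - by move=> i; rewrite f7 // f6 // f5 // f4 // v3.
  - by move=> j; rewrite f7 // f6 // f5 // v4.
  - by move=> j; rewrite f7 // f6 // v5.
  - by move=> j; rewrite f7 // v6 // -(nth_cvec eps) [reval _ _ _]/= updE sub0r.
  - by move=> j; rewrite v7 // [reval _ _ _]/= updE f6 // v5.
by rewrite /for_cost /Z /=; lia.
Qed.

Lemma augment_ok s e mu0 v r y L X mu x : 0 < e -> e < 1 -> 0 < mu0 ->
  mw_inv e mu0 v r y L X mu -> x \in S ->
  dotp (mu / (1 + e) *: aty y - cv) x < 0 ->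
  holds_vec s (orc_real 1) x -> rmem s epsA 0 = e ->
  (forall i : 'I_m, rmem s arrY i = y i) ->
  (forall i : 'I_m, rmem s arrL i = L i) ->
  (forall j : 'I_n, rmem s arrX j = X j 0) ->
  (forall i, L i <= rmem s maxA 0) -> (exists i, rmem s maxA 0 <= L i) ->
  halts inpQ augment s (1000 * Z) (fun s' =>
    (forall a, a \notin [:: arrX; arrY; arrL; arrW; sgA; maxA] -> rmem s' a = rmem s a) /\
    exists y' L' X', [/\ mw_inv e mu0 v.+1 r y' L' X' mu,
      forall i : 'I_m, rmem s' arrY i = y' i,
      forall i : 'I_m, rmem s' arrL i = L' i,
      forall j : 'I_n, rmem s' arrX j = X' j 0 &
      (forall i, L' i <= rmem s' maxA 0) /\ (exists i, rmem s' maxA 0 <= L' i)]).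
Proof.
move=> e0 e1 mu00 I xS xviol hx se sY sL sX Lmax [i1 Lmax1].
apply: halts_cost.
  apply: (halts_seq (halts_for_map eval_mE _)) => // s1 [_ f1 v1].
  apply: (halts_seq (halts_for_sum eval_NE _)); first by split=> //; left.
  move=> s2 [_ f2 v2].
  have W2 (i : 'I_m) : rmem s2 arrW i = (Amat J *m x) i 0.
    rewrite v2 v1 // add0r mxE.
    under eq_bigl => k do rewrite /= updE.
    under eq_bigr => k _ do rewrite /= updE.
    rewrite (sum_row (rmem s1 (orc_real 1))); apply: eq_bigr => j _.
    by rewrite f1 // hx.
  apply: (halts_seq (halts_rset_cell _ _ _ _)) => s3 [_ f3 v3].
  apply: (halts_seq (halts_for_max eval_mE _)).
    by split=> //; left.
  move=> s4 [_ f4 sg_ge0 sg_max sg_ex].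
  set sg := rmem s4 sgA 0 in sg_ge0 sg_max sg_ex.
  have load3 (i : 'I_m) : reval inpQ (at_loop s3 i) (RDiv (entry arrW) bE) = (Amat J *m x) i 0 / b i.
    by rewrite -nth_bval [LHS]/= updE f3 // W2.
  have sgmax (i : 'I_m) : (Amat J *m x) i 0 / b i <= sg by rewrite -load3; exact: sg_max.
  have b0 (i : 'I_m) : 0 < b i by exact: bval_gt0.
  (* Otherwise all loads of [x] would be at most 0, contradicting the positivity of their weighted
     sum [dotp (aty y) x]. *)
  have sg0 : 0 < sg.
    rewrite lt_neqAle eq_sym; move: sg_ge0; rewrite v3 /= => -> /=; rewrite andbT.
    apply/negP => /eqP sg0; have := dotp_aty_gt0 Jok Sok (fun i => mw_y_gt0 Jok i I) xS.
    rewrite dotp_aty ltNge => /negP; apply; apply: sumr_le0 => i _.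
    rewrite mulr_ge0_le0 //; first by rewrite ltW // (mw_y_gt0 Jok i I).
    by have := sgmax i; rewrite sg0 ler_pdivrMr // mul0r.
  have sgex : exists i, sg = (Amat J *m x) i 0 / b i.
    case: sg_ex => [sgE|[i im sgE]].
      by move: sg0; rewrite sgE v3 /= ltxx.
    by exists (Ordinal im); rewrite -load3.
  apply: (halts_seq (halts_for_map (@eval_nE R J eps) _)).
    by split; [right|split; left].
  move=> s5 [_ f5 v5].
  apply: (halts_seq (halts_for_map eval_mE _)).
    by split; [split=> //; right|left].
  move=> s6 [_ f6 v6].
  pose w (i : 'I_m) := (Amat J *m x) i 0 / b i / sg.
  have W6 (i : 'I_m) : rmem s6 arrW i = w i.
    rewrite v6 // /w -nth_bval -W2 [LHS]/= updE f5 // f4 // f3 // f5 //.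
  apply: (halts_seq (halts_for_map eval_mE _)).
    by split; [right|split=> //; split; left].
  move=> s7 [_ f7 v7].
  apply: (halts_seq (halts_for_map eval_mE _)).
    by split; [right|left].
  move=> s8 [_ f8 v8].
  apply: (halts_post (halts_for_max eval_mE _)); first by left.
  move=> s9 [_ f9 m_ge m_max m_ex].
  have I' := mw_step Jok Sok e0 e1 mu00 I xS xviol sg0 sgmax sgex (fun i => erefl (w i)).
  have L8 (i : 'I_m) : rmem s8 arrL i = L i + w i.
    by rewrite v8 // [LHS]/= updE !f7 // W6 f6 // f5 // f4 // f3 // f2 // f1 // sL.
  split.
    move=> a; rewrite !inE !negb_or => /and5P[/eqP a1 /eqP a2 /eqP a3 /eqP a4 /andP[/eqP a5 /eqP a6]].
    by rewrite f9 // f8 // f7 // f6 // f5 // f4 // f3 // f2 // f1.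
  exists (fun i => y i * (1 + e * w i)), (fun i => L i + w i), (X + sg^-1 *: x); split=> //.
  - move=> i; rewrite f9 // f8 // v7 // [LHS]/= updE W6 !f6 // !f5 // !f4 // !f3 // !f2 // !f1 //.
    by rewrite sY se.
  - by move=> i; rewrite f9.
  - move=> j; rewrite f9 // f8 // f7 // f6 // v5 // [LHS]/= updE -/sg (f4 arrX) // (f4 (orc_real 1)) // !f3 // !f2 // !f1 //.
    by rewrite sX hx !mxE [_^-1 * _]mulrC.
  - have m8 : rmem s8 maxA 0 = rmem s maxA 0.
      by rewrite f8 // f7 // f6 // f5 // f4 // f3 // f2 // f1.
    have w0 i : 0 <= w i by rewrite !divr_ge0 ?Amatx_ge0 // ltW.
    have at8 (i : 'I_m) : reval inpQ (at_loop s8 i) (entry arrL) = L i + w i.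
      by rewrite [LHS]/= updE L8.
    split=> [i|]; first by rewrite -at8; exact: m_max.
    case: m_ex => [->|[i im ->]].
      by exists i1; rewrite m8; apply: le_trans Lmax1 _; rewrite lerDl.
    by exists (Ordinal im); rewrite -at8.
by rewrite /for_cost /Z /=; lia.
Qed.

Let e := eps / 3.

Lemma third_gt0 : 0 < e.
Proof. by rewrite divr_gt0 //; case/andP: eps01. Qed.

Lemma third_lt : 3 * e < 1.
Proof. by move: eps01 => /andP[_]; rewrite /e; lra. Qed.

Lemma third_lt1 : e < 1.
Proof. by have := third_lt; have := third_gt0; lra. Qed.

Definition levels : nat := up_log 2 m.
Definition load_bound : R := levels%:R / (e * e).

Lemma load_bound_ge0 : 0 <= load_bound.
Proof. by rewrite divr_ge0 // mulr_ge0 // ltW // third_gt0. Qed.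

Lemma threshold_ok s : rmem s epsA 0 = e ->
  halts inpQ threshold s (100 * Z) (fun s' =>
    (forall a, a <> thrA -> rmem s' a = rmem s a) /\ rmem s' thrA 0 = load_bound).
Proof.
move=> se.
have levm : (levels <= m)%N by apply: up_log_min => //; exact: ltnW (ltn_expl _ _).
apply: halts_cost.
  apply: (@halts_seq _ _ _ _ _ _ _ (fun s1 => imem s1 powA 0 = 1%N /\ rmem s1 = rmem s)).
    by apply: halts_iset; rewrite /= updE.
  move=> s1 [p1 r1].
  apply: (halts_seq (halts_rset_cell _ _ _ _)) => s2 [i2 f2 v2].
  pose Inv j s3 := [/\ imem s3 powA 0 = (2 ^ j)%N, rmem s3 thrA 0 = j%:R, (j <= levels)%N &
    forall a, a <> thrA -> rmem s3 a = rmem s a].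
  have I0 : Inv 0%N s2.
    by split=> //; [rewrite i2 p1|move=> a ha; rewrite f2 // r1].
  apply: (halts_seq (halts_while (B := levels) (Inv := Inv) I0 _)).
    move=> j s3 [I1 I2 I3 I4]; rewrite /= I1 addn1 => jm.
    have jl : (j < levels)%N.
      rewrite ltnNge; apply/negP => lj; have := up_logP m (isT : (1 < 2)%N).
      by have := leq_pexp2l (isT : (0 < 2)%N) lj; rewrite /levels; lia.
    split; first exact: ltnW.
    apply: (@halts_seq _ _ _ _ _ _ _ (fun s4 => imem s4 powA 0 = (2 ^ j.+1)%N /\ rmem s4 = rmem s3)).
      by apply: halts_iset; rewrite /= updE I1 addnn -mul2n expnS.
    move=> s4 [p4 r4].
    apply: (halts_post (halts_rset_cell _ _ _ _)) => s5 [i5 f5 v5].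
    split=> //; first by rewrite i5.
      by rewrite v5 /= r4 I2 natr1.
    by move=> a ha; rewrite f5 // r4 I4.
  move=> s3 [ng [j [I1 I2 I3 I4]]].
  have jl : j = levels.
    apply/eqP; rewrite eqn_leq I3; apply: up_log_min => //.
    by move: ng; rewrite /= I1 addn1 -leqNgt.
  apply: (halts_post (halts_rset_cell _ _ _ _)) => s4 [_ f4 v4].
  split=> [a ha|]; first by rewrite f4 // I4.
  by rewrite v4 /= I2 jl I4 // se.
rewrite /Z /=; nia.
Qed.

Section WeightsLoop.
Variables (xs : 'cV[R]_n).
Hypothesis xsS : xs \in S.
Let mu0 := dotp cv xs / dotp (aty (unit_weights (J := J))) xs.
Hypothesis cxs_gt0 : 0 < dotp cv xs.
Hypothesis xs_max : forall z, z \in S ->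
  dotp cv z <= mu0 * dotp (aty (unit_weights (J := J))) z.

Lemma axs_gt0 : 0 < dotp (aty (unit_weights (J := J))) xs.
Proof. by apply: dotp_aty_gt0 => // i; rewrite invr_gt0 bval_gt0. Qed.

Lemma mu0_gt0 : 0 < mu0.
Proof. by rewrite divr_gt0 // axs_gt0. Qed.

Definition loop_state (v r : nat) (s : store R) : Prop :=
  exists y L X mu, [/\ mw_inv e mu0 v r y L X mu,
    forall i : 'I_m, rmem s arrY i = y i,
    forall i : 'I_m, rmem s arrL i = L i,
    forall j : 'I_n, rmem s arrX j = X j 0 &
    [/\ rmem s muA 0 = mu, rmem s epsA 0 = e, rmem s thrA 0 = load_bound,
        forall i, L i <= rmem s maxA 0 & exists i, rmem s maxA 0 <= L i]].

(** The oracle's answer decides which of the two counters advances; their sum is the loop index. *)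
Lemma iteration_ok v r s : loop_state v r s ->
  halts inpQ (iteration P) s (1200 * (Z + T_J)) (fun s' =>
    loop_state v.+1 r s' \/ loop_state v r.+1 s').
Proof.
move=> [y [L [X [mu [I sY sL sX [smu se sthr Lmax Lmax1]]]]]].
have e0 := third_gt0; have e1 := third_lt1.
apply: halts_cost.
  apply: (halts_seq (mul_trans_ok sY)) => s1 [f1 v1].
  apply: (halts_seq (halts_rset_cell _ _ _ _)) => s2 [_ f2 v2].
  have lam2 : rmem s2 lamA 0 = mu / (1 + e) by rewrite v2 /= !f1 // smu se.
  pose d := mu / (1 + e) *: aty y - cv.
  have dE (j : 'I_n) : d j 0 = rmem s2 lamA 0 * rmem s2 arrA j - cv j 0.
    by rewrite lam2 f2 // v1 [LHS]mxE [X in X + _]mxE [X in _ + X]mxE.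
  apply: (halts_seq (query_ok P_oracle eps FJ dE)) => s3 [f3 _ E3].
  (* Arrays of residue 0 modulo 4 are out of reach of the renamed oracle. *)
  have own3 a : (a %% 4 = 0)%N -> a <> arrA -> a <> lamA -> rmem s3 a = rmem s a.
    move=> a4 aA aL; rewrite f3 ?f2 ?f1 // => k; rewrite /orc_real; lia.
  apply: halts_if => /=; rewrite leqn0 => fl; move: E3.
    rewrite fl => E3; apply: (halts_post (halts_rset_cell _ _ _ _)) => s4 [_ f4 v4].
    right; exists y, L, X, (mu / (1 + e)); split.
    - by apply: mw_lower_mu I _ => //; exact: mu0_gt0.
    - by move=> i; rewrite f4 // own3.
    - by move=> i; rewrite f4 // own3.
    - by move=> j; rewrite f4 // own3.
    - split; rewrite ?(f4 epsA) ?(f4 thrA) ?(f4 maxA) ?own3 //.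
      by rewrite v4 /= f3 // /lamA /orc_real; lia.
  rewrite (negPf fl) => -[x [xS xviol hx]].
  have max3 : rmem s3 maxA 0 = rmem s maxA 0 by rewrite own3.
  have := @augment_ok s3 e mu0 v r y L X mu x e0 e1 mu0_gt0 I xS xviol hx.
  rewrite max3 !own3 //; move/(_ se sY sL sX Lmax Lmax1) => H.
  apply: halts_post H _ => s4 [f4 [y' [L' [X' [I' Y' L4 X4 [max4 ex4]]]]]].
  left; exists y', L', X', mu; split=> //; split=> //; rewrite f4 //.
  - by rewrite own3.
  - by rewrite own3.
  - by rewrite own3.
by rewrite /query_cost /Z /=; lia.
Qed.

Definition iteration_bound : nat := Num.truncn ((m%:R + 2) * load_bound).

Lemma weights_loop_ok s : rmem s epsA 0 = e ->
  (forall i : 'I_m, rmem s arrY i = unit_weights i) ->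
  (forall i : 'I_m, rmem s arrL i = 0) ->
  (forall j : 'I_n, rmem s arrX j = 0) ->
  rmem s cxA 0 = dotp cv xs -> rmem s axA 0 = dotp (aty (unit_weights (J := J))) xs ->
  halts inpQ (weights_loop P) s (iteration_bound.+2 * (1300 * (Z + T_J))) (fun s' =>
    exists x, [/\ holds_vec s' 1 x, @feasible R J x & (1 - eps) * optimum J <= objective x]).
Proof.
move=> se sY sL sX scx sax.
have e0 := third_gt0; have e1 := third_lt1.
have tb0 : 0 <= (m%:R + 2) * load_bound.
  by rewrite mulr_ge0 ?load_bound_ge0 // addr_ge0.
apply: halts_cost.
  apply: (halts_seq (halts_rset_cell _ _ _ _)) => s1 [_ f1 v1].
  have se1 : rmem s1 epsA 0 = e by rewrite f1.
  apply: (halts_seq (threshold_ok se1)) => s2 [f2 v2].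
  apply: (halts_seq (halts_rset_cell _ _ _ _)) => s3 [_ f3 v3].
  pose Inv j s := exists v r, j = (v + r)%N /\ loop_state v r s.
  have I0 : Inv 0%N s3.
    exists 0%N, 0%N; split=> //.
    exists (unit_weights (J := J)), (fun=> 0), 0, mu0; split.
    - exact: mw_init.
    - by move=> i; rewrite f3 // f2 // f1.
    - by move=> i; rewrite f3 // f2 // f1.
    - by move=> j; rewrite f3 // f2 // f1 // sX mxE.
    - split.
      + by rewrite f3 // f2 // v1 /= scx sax.
      + by rewrite f3 // f2.
      + by rewrite f3.
      + by move=> i; rewrite v3.
      rewrite v3 /=.
      (* A row is needed to witness the maximal load 0: [xs] is nonzero, so some column exists, and
         every column of [A] has a positive entry. *)
      have [xs0 _] := Sok xsS.
      have [j _] : exists j, xs j 0 != 0.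
        apply/existsP; apply: contraNT xs0; rewrite negb_exists => /forallP H.
        apply/eqP/matrixP => j k; rewrite !ord1 mxE; apply/eqP.
        by have := H j; rewrite negbK.
      by case: Jok => _ /(_ j)[i _] _; exists i.
  apply: (halts_seq (halts_while (B := iteration_bound) (Inv := Inv) I0 _)).
    move=> _ s4 [v [r [-> st]]] /= guard; split.
      (* A true guard means that all loads are still within the threshold, so the bound of
         [mw_iterations] holds for the iterations made so far. *)
      have [y [L [X [mu [I _ _ _ [_ _ sthr Lmax _]]]]]] := st.
      rewrite truncn_ge_nat //.
      apply: (mw_iterations Jok Sok e0 e1 mu0_gt0 I load_bound_ge0 _ xsS).
        by move=> i; apply: le_trans (Lmax i) _; rewrite -sthr.
      by rewrite /mu0 divfK // gt_eqF // axs_gt0.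
    apply: halts_post (iteration_ok st) _ => s5 [st'|st'].
      by exists v.+1, r.
    by exists v, r.+1; rewrite addnS.
  move=> s4 [/= guard [_ [v [r [_ st]]]]].
  have [y [L [X [mu [I _ _ X4 [_ _ sthr Lmax Lmax1]]]]]] := st.
  apply: (halts_post (halts_for_map (@eval_nE R J eps) _)).
    by split; left.
  move=> s5 [_ f5 v5].
  move: guard; rewrite -ltNge sthr => guard.
  have [fx opt] := mw_final Jok e0 e1 I Lmax Lmax1 guard (up_logP m (isT : (1 < 2)%N)) third_lt.
  exists ((rmem s4 maxA 0)^-1 *: X); split=> //.
    by move=> j; rewrite v5 // [LHS]/= updE X4 !mxE mulrC.
  apply: optimum_le; first by case/andP: eps01; rewrite subr_gt0.
  have -> : 1 - eps = 1 - 3 * e by rewrite /e; lra.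
  exact: opt.
rewrite /for_cost /Z /=; nia.
Qed.

End WeightsLoop.

(** If no generator has positive objective then no point of the cone has, and the zero vector is
    optimal. This covers both an empty [S] and a nonpositive critical ratio. *)
Lemma output_zero_ok s : (forall z, z \in S -> dotp cv z <= 0) ->
  halts inpQ output_zero s (30 * Z) (fun s' =>
    exists x, [/\ holds_vec s' 1 x, @feasible R J x & (1 - eps) * optimum J <= objective x]).
Proof.
move=> cS; apply: halts_cost.
  apply: (halts_post (halts_for_map (@eval_nE R J eps) _)) => // s1 [_ f1 v1].
  exists 0; split.
  - by move=> j; rewrite v1 // mxE.
  - exact: feasible0.
  - have obj0 : objective (0 : 'cV[R]_n) = 0.
      by rewrite /objective /dotp big1 // => j _; rewrite [X in _ * X]mxE mulr0.
    rewrite obj0; apply: optimum_le; first by case/andP: eps01; rewrite subr_gt0.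
    move=> z [_ zc]; rewrite mulr_ge0_le0 //; first by case/andP: eps01; rewrite subr_ge0 => _ /ltW.
    have : 0 <= dotp (0 *: cv - cv) z.
      by apply: dotp_cone_ge0 zc => x xS; rewrite dotpBl dotpZl mul0r sub0r oppr_ge0 cS.
    by rewrite dotpBl dotpZl mul0r sub0r oppr_ge0.
rewrite /for_cost /Z /=; lia.
Qed.

Definition fptas_cost : nat :=
  (loop_factor * (iteration_bound.+2 * (Z + T_J)) + search_cost T J)%N.

Lemma fptas_ok (dep : pred nat) s : dep 0%N -> combinatorial_cmd dep P ->
  halts inpQ (fptas dep P) s fptas_cost (fun s' =>
    exists x, [/\ holds_vec s' 1 x, @feasible R J x & (1 - eps) * optimum J <= objective x]).
Proof.
move=> dep0 Pc; apply: halts_cost.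
  apply: (halts_seq (setup_ok s)) => s1 [se sY sL sX [sA sC sD]].
  have a0 j : 0 < aty (unit_weights (J := J)) j 0.
    by apply: aty_gt0 => // i; rewrite invr_gt0 bval_gt0.
  have H := halts_frame (parametric_search gens_nonneg P_oracle eps FJ dep0 Pc sA a0 erefl sC sD).
  apply: (halts_seq H) => s2 [[A2 E2] _ fr2].
  (* The search writes to residues 1, 2 and 3, to the cells holding a comparison, and to [lamA]; the
     data prepared by [setup] survives. *)
  have own2 a : (a %% 4 = 0)%N -> a \notin [:: cmpA; cmpB; lamA] -> rmem s2 a = rmem s1 a.
    move=> a4; rewrite !inE !negb_or => /and3P[/eqP aA /eqP aB /eqP aL].
    apply: fr2; apply/negP => /rwrites_sim[[k []]|[]|] //.
    - by rewrite /sim_cst; lia.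
    - by rewrite /sim_lin; lia.
    - move=> /=; rewrite !orbF => h.
      suff [/eqP|[/eqP|/rwrites_cren[k]]] : a == lamA \/ a == orc_real 0 \/ rwrites (cren orc_int orc_real P) a => //.
      + by rewrite /orc_real; lia.
      + by rewrite /orc_real; lia.
      by move: h => /orP[] /or3P[]; auto.
  apply: halts_if => /=; rewrite leqn0 => fl; move: E2.
    by rewrite fl => S0; apply: output_zero_ok => z; rewrite S0.
  rewrite (negPf fl) => -[xs [xsS hxs xmax]].
  apply: (halts_seq (halts_rset_cell _ _ _ _)) => s3 [_ f3 v3].
  apply: (halts_seq (halts_for_sum (@eval_nE R J eps) _)).
    by split=> //; left.
  move=> s4 [_ f4 v4].
  apply: (halts_seq (halts_rset_cell _ _ _ _)) => s5 [_ f5 v5].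
  apply: (halts_seq (halts_for_sum (@eval_nE R J eps) _)).
    by split; left.
  move=> s6 [_ f6 v6].
  have cx6 : rmem s6 cxA 0 = dotp cv xs.
    rewrite f6 // f5 // v4 v3 /= add0r; apply: eq_big => //= k _.
    by rewrite !updE -(nth_cvec eps) f3 // hxs.
  have ax6 : rmem s6 axA 0 = dotp (aty (unit_weights (J := J))) xs.
    rewrite v6 v5 /= add0r; apply: eq_big => //= k _.
    by rewrite !updE !f5 // !f4 // !f3 // hxs A2 sA.
  have axs := axs_gt0 xsS.
  apply: halts_if => /=; rewrite cx6 => cx.
    apply: output_zero_ok => z zS; apply: le_trans (xmax z zS) _.
    rewrite mulr_le0_ge0 //; last by rewrite ltW // dotp_aty_gt0 // => i; rewrite invr_gt0 bval_gt0.
    by rewrite mulr_le0_ge0 // invr_ge0 ltW.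
  rewrite -ltNge in cx.
  apply: (weights_loop_ok xsS cx xmax) => //.
  - by rewrite f6 // f5 // f4 // f3 // own2.
  - by move=> i; rewrite f6 // f5 // f4 // f3 // own2.
  - by move=> i; rewrite f6 // f5 // f4 // f3 // own2.
  - by move=> i; rewrite f6 // f5 // f4 // f3 // own2.
rewrite /fptas_cost /loop_factor /for_cost /Z /=; nia.
Qed.

End Program.

                     

(** * Sparsity counts and the running time *)

Section NonzeroCount.
Variables (R : realType) (J : packing R).
Hypothesis Jok : packing_ok J.

Lemma nnz_le_mul : (nnz J <= nrows J * cone_dim (pcone J))%N.
Proof. by apply: leq_trans (max_card _) _; rewrite card_prod !card_ord. Qed.

Lemma cone_dim_le_nnz : (cone_dim (pcone J) <= nnz J)%N.
Proof.
rewrite -[leqLHS]card_ord -cardsT.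
apply: leq_trans (leq_imset_card snd (mem (nonzeros J))); apply: subset_leq_card.
apply/fintype.subsetP => j _; case: Jok => _ /(_ j)[i Aij] _.
by apply/imsetP; exists (i, j) => //; rewrite inE -lt0n.
Qed.

Lemma nrows_le_nnz : (nrows J <= nnz J)%N.
Proof.
rewrite -[leqLHS]card_ord -cardsT.
apply: leq_trans (leq_imset_card fst (mem (nonzeros J))); apply: subset_leq_card.
apply/fintype.subsetP => i _; case: Jok => /(_ i)[j Aij] _ _.
by apply/imsetP; exists (i, j) => //; rewrite inE -lt0n.
Qed.

End NonzeroCount.

Lemma oracle_time_gt0 (R : realType) (F : cone_inst R -> Prop) P T I :
  separation_oracle F P T -> F I -> (0 < T I)%N.
Proof.
move=> PO FI; pose s : store R := Store (fun _ _ => 0%N) (fun _ _ => 0).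
have hs : holds_vec s 0 (0 : 'cV[R]_(cone_dim I)) by move=> j; rewrite mxE.
have [s' [t [/run_gt0 t0 tT _]]] := PO I FI 0 s hs.
exact: leq_trans tT.
Qed.

Lemma ln2_ge_half (R : realType) : 2^-1 <= ln 2 :> R.
Proof.
rewrite -ler_expR lnK ?posrE //.
rewrite -[leRHS]invrK -[leLHS]invrK -expRN lef_pV2 ?posrE ?expR_gt0 ?invr_gt0 //.
by apply: le_trans (expR_ge1Dx _); lra.
Qed.

(** Write the left side as [k + 1] with [2 ^ k < m]. Since [ln 2] is at least one half, both [k] and
    [1] are at most [2 ln m]. *)
Lemma up_log2_le_ln (R : realType) (m : nat) : (1 < m)%N ->
  (up_log 2 m)%:R <= 4 * ln m%:R :> R.
Proof.
move=> m1; have := up_log_gtn (isT : (1 < 2)%N) m1.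
have : (0 < up_log 2 m)%N by rewrite up_log_gt0.
case: (up_log 2 m) => // k _ /=; rewrite -(ltr_nat R) natrX => km.
have m0 : 0 < m%:R :> R by rewrite ltr0n; lia.
have l2 := ln2_ge_half R.
have lm : ln 2 <= ln m%:R :> R by rewrite ler_ln ?posrE // ler_nat.
have : k%:R * ln 2 <= ln m%:R :> R.
  rewrite mulr_natl -lnXn // ler_ln ?posrE ?exprn_gt0 //; exact: ltW.
have k0 : 0 <= k%:R :> R by [].
rewrite -natr1; nra.
Qed.

Section RunningTime.
Variables (R : realType) (F : cone_inst R -> Prop) (P : cmd) (T : cone_inst R -> nat).
Hypothesis P_oracle : separation_oracle F P T.
Variable kappa : R.
Hypothesis kappa_gt0 : 0 < kappa.
Hypothesis T_Omega : forall I, F I -> kappa * (cone_dim I)%:R <= (T I)%:R.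

Definition time_bound (J : packing R) (eps : R) : R :=
  eps ^- 2 * ((nrows J)%:R * ln (nrows J)%:R) * ((nnz J)%:R + (T (pcone J))%:R)
  + (T (pcone J))%:R ^+ 2.

Lemma ln_nat_ge0 (m : nat) : 0 <= m%:R * ln m%:R :> R.
Proof.
case: m => [|m]; first by rewrite mul0r.
by rewrite mulr_ge0 // ln_ge0 // ler1n.
Qed.

(** The summand 296 comes from the main loop with at least two rows, [2 * (2 * kappa^-1 + 3)] from
    the loop with at most one row, and [35 * kappa^-1 + 117] from the parametric search. *)
Definition time_factor : R :=
  loop_factor%:R * (296 + 2 * (2 * kappa^-1 + 3)) + 35 * kappa^-1 + 117.

Lemma fptas_cost_le (J : packing R) (eps : R) : F (pcone J) -> packing_ok J ->
  0 < eps < 1 -> (fptas_cost T J eps)%:R <= time_factor * time_bound J eps.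
Proof.
move=> FJ Jok /andP[e0 e1].
have T1 : 1 <= (T (pcone J))%:R :> R by rewrite ler1n; exact: (oracle_time_gt0 P_oracle FJ).
have k1 : 0 < kappa^-1 by rewrite invr_gt0.
have nT : (cone_dim (pcone J))%:R <= kappa^-1 * (T (pcone J))%:R.
  by rewrite mulrC ler_pdivlMr // mulrC; exact: T_Omega.
have Nmn := nnz_le_mul J; have nN := cone_dim_le_nnz Jok; have mN := nrows_le_nnz Jok.
have q0 := ln_nat_ge0 (nrows J).
rewrite /fptas_cost /search_cost /query_cost /time_bound.
set t := (T (pcone J))%:R in T1 nT *.
set q := (nrows J)%:R * _ in q0 *.
have ei2 : 1 <= eps ^- 2.
  by rewrite -exprVn exprn_ege1 // invf_ge1 // ltW.
rewrite natrD !natrM !natrD natrM -/t -[(cone_dim _).+1]addn1 -[_.+2]addn2 !natrD.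
rewrite /time_factor.
set c : R := loop_factor%:R; have c0 : 0 <= c by [].
clearbody c; move: (kappa^-1) k1 nT => ki k1 nT.
set n := (cone_dim (pcone J))%:R in nT *.
have n0 : 0 <= n by [].
set B := (iteration_bound J eps)%:R.
have search : (35 * (n + 1) + t + 1 + 80) * t <= (35 * ki + 117) * t ^+ 2 by nra.
(* With at most one row [m ln m] vanishes, so the first term of the bound gives nothing. But then
   the threshold is 0, the number of iterations is bounded by a constant and [N <= n], so the square
   of the oracle time absorbs everything. *)
have [m1|m1] := leqP (nrows J) 1.
  have B0 : B = 0.
    have lev : levels J = 0%N by apply/eqP; rewrite /levels up_log_eq0 m1 orbT.
    by rewrite /B /iteration_bound /load_bound lev mul0r mulr0 truncn0.
  have NR : (nnz J)%:R <= n.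
    by rewrite /n ler_nat; apply: leq_trans Nmn _; rewrite -[leqRHS]mul1n leq_mul2r m1 orbT.
  have mR : (nrows J)%:R <= 1 :> R by rewrite -[1]/1%:R ler_nat.
  have /(ler_wpM2l c0) h : (B + 2) * (n + (nrows J)%:R + (nnz J)%:R + 1 + t) <=
     2 * (2 * ki + 3) * t ^+ 2.
    rewrite B0 add0r.
    have h1 : n + (nrows J)%:R + (nnz J)%:R + 1 + t <= (2 * ki + 3) * t by lra.
    have h2 : (2 * ki + 3) * t <= (2 * ki + 3) * t ^+ 2.
      by apply: ler_wpM2l; [lra|rewrite expr2 ler_peMr //; lra].
    lra.
  have r0 : 0 <= eps ^- 2 * q * ((nnz J)%:R + t).
    by apply: mulr_ge0; [apply: mulr_ge0 => //; lra|apply: addr_ge0 => //; lra].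
  have t2 : 0 <= t ^+ 2 by exact: sqr_ge0.
  have f0 : 0 <= c * (296 + 2 * (2 * ki + 3)) + 35 * ki + 117.
    by apply: addr_ge0 => //; apply: addr_ge0; [apply: mulr_ge0 => //; lra|lra].
  have h0 := mulr_ge0 f0 r0.
  have h1 : 0 <= c * 296 * t ^+ 2 by apply: mulr_ge0 => //; lra.
  rewrite [leRHS]mulrDr; lra.
set Q := eps ^- 2 * q.
have lnm := up_log2_le_ln R m1.
have m2 : 2 <= (nrows J)%:R :> R by rewrite ler_nat.
have l2 : 2^-1 <= ln (nrows J)%:R :> R.
  by apply: le_trans (ln2_ge_half R) _; rewrite ler_ln ?posrE //; lra.
have q1 : 1 <= q by rewrite /q; nra.
have Q1 : 1 <= Q by rewrite /Q; nra.
(* The constant is 2 times 9 times 4, from [m + 2 <= 2 m], from [e = eps / 3], and from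
   [up_log2_le_ln]. *)
have BQ : B <= 72 * Q.
  have tb0 : 0 <= ((nrows J)%:R + 2) * load_bound J eps.
    rewrite mulr_ge0 ?addr_ge0 // /load_bound divr_ge0 // mulr_ge0 // divr_ge0 // ltW //.
  apply: (@le_trans _ _ (((nrows J)%:R + 2) * load_bound J eps)).
    by rewrite /B /iteration_bound truncn_le.
  have -> : load_bound J eps = 9 * eps ^- 2 * (up_log 2 (nrows J))%:R.
    by rewrite /load_bound /levels; field; lra.
  have -> : 72 * Q = (2 * (nrows J)%:R) * (9 * eps ^- 2 * (4 * ln (nrows J)%:R)).
    by rewrite /Q /q; ring.
  apply: ler_pM; rewrite ?addr_ge0 //; first by rewrite !mulr_ge0 //; lra.
    by lra.
  by apply: ler_wpM2l => //; rewrite mulr_ge0 //; lra.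
have NR : n + (nrows J)%:R + (nnz J)%:R + 1 + t <= 4 * ((nnz J)%:R + t).
  have : n <= (nnz J)%:R by rewrite ler_nat.
  have : (nrows J)%:R <= (nnz J)%:R :> R by rewrite ler_nat.
  lra.
have /(ler_wpM2l c0) h : (B + 2) * (n + (nrows J)%:R + (nnz J)%:R + 1 + t) <=
   296 * (Q * ((nnz J)%:R + t)).
  have -> : 296 * (Q * ((nnz J)%:R + t)) = (74 * Q) * (4 * ((nnz J)%:R + t)) by ring.
  have B0 : 0 <= B by [].
  have N0 : 0 <= (nnz J)%:R :> R by [].
  have M0 : 0 <= (nrows J)%:R :> R by [].
  by apply: ler_pM; lra.
have QN : 0 <= Q * ((nnz J)%:R + t) by apply: mulr_ge0; [lra|apply: addr_ge0 => //; lra].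
have t2 : 0 <= t ^+ 2 by exact: sqr_ge0.
have h1 : 0 <= (c * (2 * (2 * ki + 3)) + 35 * ki + 117) * (Q * ((nnz J)%:R + t)).
  apply: mulr_ge0 => //; apply: addr_ge0 => //; apply: addr_ge0; last lra.
  by apply: mulr_ge0 => //; lra.
have h2 : 0 <= c * (296 + 2 * (2 * ki + 3)) * t ^+ 2.
  by apply: mulr_ge0 => //; apply: mulr_ge0 => //; lra.
rewrite [leRHS]mulrDr; lra.
Qed.

End RunningTime.

(** Everything is compared with [u], the size plus [1 / eps]. As [1 / eps] exceeds 1, [u] also
    dominates the successor of the cone size, so [T] is at most [kT u ^ kT]. *)
Lemma time_bound_poly (R : realType) (F : cone_inst R -> Prop) (T : cone_inst R -> nat) (K : R) :
  0 <= K -> strongly_polynomial F T ->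
  exists k : nat, forall (J : packing R) (eps : R), F (pcone J) -> 0 < eps < 1 ->
    K * time_bound T J eps <= k%:R * ((packing_size J)%:R + eps^-1) ^+ k.
Proof.
move=> K0 [kT Tle].
(* The exponent covers 2 for [eps ^- 2], 2 for [m ln m] and [kT + 1] for the sum of [N] and [T] in
   the first term, and [2 kT] for the square of [T]. *)
pose C := K * (1 + kT%:R + kT%:R ^+ 2); pose E := (5 + 2 * kT)%N.
have E1 : (4 + kT.+1 <= E)%N by rewrite /E; lia.
have E2 : (kT * 2 <= E)%N by rewrite /E; lia.
have C0 : 0 <= C by apply: mulr_ge0 => //; apply: addr_ge0; rewrite ?sqr_ge0 ?addr_ge0.
pose k := maxn (Num.truncn C).+1 E.
exists k => J eps FJ /andP[e0 e1].
set u := (packing_size J)%:R + eps^-1.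
have ei : 1 < eps^-1 by rewrite invf_gt1.
have u1 : 1 <= u by rewrite /u; have : 0 <= (packing_size J)%:R :> R; [by []|lra].
have u0 : 0 < u by lra.
have upow i j : (i <= j)%N -> u ^+ i <= u ^+ j by move=> ij; exact: ler_weXn2l.
have sz (a : nat) : (a <= packing_size J)%N -> a%:R <= u.
  move=> ha; rewrite /u; have : a%:R <= (packing_size J)%:R :> R by rewrite ler_nat.
  lra.
have mu : (nrows J)%:R <= u by apply: sz; rewrite /packing_size; lia.
have Nu : (nnz J)%:R <= u by apply: sz; rewrite /packing_size; lia.
have lu : ln (nrows J)%:R <= u.
  have [m0|m0] := posnP (nrows J); first by rewrite m0 ln0 //; lra.
  have := @le_ln1Dx R ((nrows J)%:R - 1).
  rewrite [1 + _]addrC subrK => H; apply: (le_trans (H _)); last by lra.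
  have : 1 <= (nrows J)%:R :> R by rewrite ler1n.
  lra.
have Tu : (T (pcone J))%:R <= kT%:R * u ^+ kT.
  apply: (@le_trans _ _ (kT * (cone_size (pcone J)).+1 ^ kT)%:R).
    by rewrite ler_nat; exact: Tle.
  rewrite natrM natrX ler_wpM2l // lerXn2r ?nnegrE //; first lra.
  rewrite -natr1 /u; have : (cone_size (pcone J))%:R <= (packing_size J)%:R :> R.
    by rewrite ler_nat /packing_size; lia.
  lra.
have bound : time_bound T J eps <= (1 + kT%:R + kT%:R ^+ 2) * u ^+ E.
  have e2 : eps ^- 2 <= u ^+ 2.
    rewrite -exprVn lerXn2r ?nnegrE //; [lra|lra|].
    by rewrite /u lerDr.
  have q : eps ^- 2 * ((nrows J)%:R * ln (nrows J)%:R) <= u ^+ 4.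
    have -> : u ^+ 4 = u ^+ 2 * (u * u) by ring.
    apply: ler_pM => //.
    - by rewrite invr_ge0 exprn_ge0 // ltW.
    - exact: ln_nat_ge0.
    - have [m0|m0] := posnP (nrows J); first by rewrite m0 mul0r; nra.
      by apply: ler_pM => //; rewrite ln_ge0 // ler1n.
  have NT : (nnz J)%:R + (T (pcone J))%:R <= (1 + kT%:R) * u ^+ kT.+1.
    rewrite mulrDl mul1r; apply: lerD.
      by apply: le_trans Nu _; rewrite -[leLHS]expr1; exact: upow.
    by apply: le_trans Tu _; rewrite ler_wpM2l //; exact: upow.
  rewrite /time_bound mulrDl; apply: lerD.
    apply: (@le_trans _ _ (u ^+ 4 * ((1 + kT%:R) * u ^+ kT.+1))).
      apply: ler_pM => //; last by rewrite addr_ge0.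
      by rewrite mulr_ge0 ?ln_nat_ge0 // invr_ge0 exprn_ge0 // ltW.
    rewrite mulrCA -exprD ler_wpM2l ?addr_ge0 //.
    exact: upow _ _ E1.
  apply: (@le_trans _ _ ((kT%:R * u ^+ kT) ^+ 2)).
    by rewrite lerXn2r ?nnegrE // mulr_ge0 // exprn_ge0 // ltW.
  rewrite exprMn ler_wpM2l ?sqr_ge0 // -exprM.
  exact: upow _ _ E2.
apply: (le_trans (ler_wpM2l K0 bound)); rewrite mulrA -/C.
apply: ler_pM => //; first by rewrite exprn_ge0 // ltW.
  apply: (@le_trans _ _ (Num.truncn C).+1%:R); last by rewrite ler_nat leq_maxl.
  by have /andP[_ /ltW] := truncn_itv C0.
by apply: upow; exact: leq_maxr.
Qed.

Theorem theorem5 (R : realType) (F : cone_inst R -> Prop) (P : cmd)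
    (T : cone_inst R -> nat)
    (gens_nonneg : forall I, F I -> gens_ok I)
    (P_comb : strongly_combinatorial P)
    (P_oracle : separation_oracle F P T)
    (T_poly : strongly_polynomial F T)
    (T_Omega_n : exists2 kappa : R, 0 < kappa &
       forall I, F I -> kappa * (cone_dim I)%:R <= (T I)%:R) :
  exists Q : cmd, strongly_polynomial_FPTAS F Q /\
    exists K : R, runs_within F Q (fun J eps =>
      K * (eps ^- 2 * ((nrows J)%:R * ln (nrows J)%:R)
             * ((nnz J)%:R + (T (pcone J))%:R)
           + (T (pcone J))%:R ^+ 2)).
Proof.
have [kappa kappa0 T_Omega] := T_Omega_n.
have [dep [dep0 Pc]] := P_comb.
have run_ok (J : packing R) (eps : R) (FJ : F (pcone J)) (Jok : packing_ok J)
    (eps01 : 0 < eps < 1) s :=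
  fptas_ok gens_nonneg P_oracle FJ Jok eps01 s dep0 Pc.
have cost := fptas_cost_le P_oracle kappa0 T_Omega.
have fast : runs_within F (fptas dep P) (fun J eps => time_factor kappa * time_bound T J eps).
  move=> J eps FJ Jok eps01 s; have [s' [t [r tc _]]] := run_ok J eps FJ Jok eps01 s.
  by exists s', t; split=> //; apply: le_trans (cost J eps FJ Jok eps01); rewrite ler_nat.
exists (fptas dep P); split; last by exists (time_factor kappa).
split.
  move=> J eps FJ Jok eps01 s.
  have [s' [t [r _ [x [hx fx ox]]]]] := run_ok J eps FJ Jok eps01 s.
  by exists s', t, x.
have K0 : 0 <= time_factor kappa.
  have : 0 < kappa^-1 by rewrite invr_gt0.
  rewrite /time_factor; move: (kappa^-1) => ki k1.
  by apply: addr_ge0 => //; apply: addr_ge0; [apply: mulr_ge0 => //; lra|lra].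
have [k Hk] := time_bound_poly K0 T_poly.
exists k => J eps FJ Jok eps01 s; have [s' [t [r tle]]] := fast J eps FJ Jok eps01 s.
by exists s', t; split=> //; apply: le_trans tle _; exact: Hk.
Qed.
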